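(* For any $C^*$-dynamical system $(\mathcal{A},G,\alpha)$, $$\Lambda(\mathcal{A})\le\Lambda(\mathcal{A}\times_{\alpha,r}G).$$
   Context: A $C^*$-dynamical system $(\mathcal{A},G,\alpha)$ consists of a $C^*$-algebra $\mathcal{A}$, a locally compact group $G$, and a homomorphism $\alpha:G\to\mathrm{Aut}(\mathcal{A})$ such that $t\mapsto\alpha_t(a)$ is norm-continuous on $G$ for every $a\in\mathcal{A}$. Reduced crossed product $\mathcal{A}\times_{\alpha,r}G$: take a faithful representation $\pi:\mathcal{A}\to B(H)$; define $\tilde\pi:\mathcal{A}\to B(L^2(G,H))$ by $(\tilde\pi(a)\xi)(t)=\pi(\alpha_{t^{-1}}(a))\xi(t)$ and unitaries $\lambda_s$ by $(\lambda_s\xi)(t)=\xi(s^{-1}t)$. Then $\mathcal{A}\times_{\alpha,r}G$ is the norm closed linear span of the operators $\int f(s)\tilde\pi(a)\lambda_s\,ds$, with $a\in\mathcal{A}$, $f$ a continuous compactly supported function on $G$, and $ds$ left Haar measure. It is a $C^*$-algebra independent of the choice of $\pi$. Haagerup constant: a $C^*$-algebra $\mathcal{A}$ has the completely bounded approximation property if there is a net of finite rank linear maps $T_\gamma:\mathcal{A}\to\mathcal{A}$, uniformly bounded in the completely bounded norm, converging to the identity in the point norm topology. $\Lambda(\mathcal{A})$ is the smallest constant that bounds $\|T_\gamma\|_{cb}$ for all $\gamma$ for some such net; $\Lambda(\mathcal{A})=\infty$ if no such net exists. *)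

(* Defs.v *)
From HB Require Import structures.
From mathcomp Require Import all_boot all_order all_algebra.
From mathcomp Require Import all_classical all_reals all_analysis.
From mathcomp Require Import complex.

Set Implicit Arguments.
Unset Strict Implicit.
Unset Printing Implicit Defensive.

Import Order.TTheory GRing.Theory Num.Theory.
Import numFieldNormedType.Exports.

Local Open Scope classical_set_scope.
Local Open Scope complex_scope.
Local Open Scope ring_scope.

(* The norm of a normed space over R[i] takes its values in R[i]; rnorm is the
   same number seen in R. *)
Definition rnorm (R : realType) (V : normedModType R[i]) (x : V) : R :=
  complex.Re `|x|.

(* The multiplication is a separate field because ring structures have a unit,
   whereas C*-algebras need not have one. *)
Record cstarAlgebra (R : realType) := CStarAlgebra {
  cstar_car :> completeNormedModType R[i] ;
  cmul : cstar_car -> cstar_car -> cstar_car ;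
  cstar : cstar_car -> cstar_car ;
  cmulA : forall a b c, cmul a (cmul b c) = cmul (cmul a b) c ;
  cmul_linearl : forall (k : R[i]) a b c,
    cmul (k *: a + b) c = k *: cmul a c + cmul b c ;
  cmul_linearr : forall (k : R[i]) a b c,
    cmul a (k *: b + c) = k *: cmul a b + cmul a c ;
  cstarK : forall a, cstar (cstar a) = a ;
  cstar_antilinear : forall (k : R[i]) a b,
    cstar (k *: a + b) = k^* *: cstar a + cstar b ;
  cstarM : forall a b, cstar (cmul a b) = cmul (cstar b) (cstar a) ;
  cnormM : forall a b, `|cmul a b| <= `|a| * `|b| ;
  cnorm_cstar : forall a, `|cmul (cstar a) a| = `|a| ^+ 2 }.

(* The inner product is linear in its first argument. *)
Record hilbertSpace (R : realType) := HilbertSpace {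
  hilbert_car :> completeNormedModType R[i] ;
  ip : hilbert_car -> hilbert_car -> R[i] ;
  ip_linearl : forall (k : R[i]) x y z,
    ip (k *: x + y) z = k * ip x z + ip y z ;
  ip_conj : forall x y, ip y x = (ip x y)^* ;
  ip_norm : forall x, ip x x = `|x| ^+ 2 }.

Section Operators.
Variables (R : realType) (H : hilbertSpace R).

(* B(H), as a subset of the R[i]-module of all functions H -> H *)
Definition bounded_op (P : H -> H) : Prop :=
  linear P /\ exists M : R, forall v, rnorm (P v) <= M * rnorm v.

Definition opnorm (P : H -> H) : \bar R :=
  ereal_sup [set (rnorm (P v))%:E | v in [set v : H | rnorm v <= 1]].

(* the norm of a matrix of operators, acting on the Hilbert sum H^n *)
Definition mxopnorm (n : nat) (X : 'M[H -> H]_n) : \bar R :=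
  ereal_sup [set (Num.sqrt (\sum_(i < n)
                     rnorm (\sum_(j < n) X i j (v j)) ^+ 2))%:E
            | v in [set v : 'I_n -> H | \sum_(j < n) rnorm (v j) ^+ 2 <= 1]].

End Operators.

Section Representations.
Variables (R : realType) (A : cstarAlgebra R) (H : hilbertSpace R).

Record star_representation (sigma : A -> H -> H) : Prop := {
  srep_bounded : forall a, bounded_op (sigma a) ;
  srep_linear : linear sigma ;
  srep_mul : forall a b, sigma (cmul a b) = sigma a \o sigma b ;
  srep_star : forall a x y, ip (sigma (cstar a) x) y = ip x (sigma a y) }.

Definition faithful_rep (sigma : A -> H -> H) : Prop :=
  star_representation sigma /\ injective sigma.

End Representations.

(* The C*-norm of the *-algebra M_n(A): the norm of M_n(sigma(A)) in B(H^n),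
   which is the same for all faithful representations sigma of A on some H. *)
Definition mxnorm (R : realType) (A : cstarAlgebra R) (n : nat)
    (a : 'M[A]_n) : \bar R :=
  ereal_sup [set r | exists (H : hilbertSpace R) (sigma : A -> H -> H),
                       faithful_rep sigma /\ r = mxopnorm (map_mx sigma a)].

(* The Haagerup constant of a linear subspace X of V, with respect to a norm nm
   on X and norms mnm n on the spaces M_n(X).  Maps X -> X are represented by
   maps V -> V, of which only the restriction to X matters. *)
Section HaagerupConstant.
Variables (R : realType) (V : lmodType R[i]) (X : set V).
Variables (nm : V -> \bar R) (mnm : forall n : nat, 'M[V]_n -> \bar R).

Record finite_rank_map (T : V -> V) : Prop := {
  frm_stable : forall x, X x -> X (T x) ;
  frm_linear : forall (k : R[i]) x y, X x -> X y ->
    T (k *: x + y) = k *: T x + T y ;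
  frm_rank : exists (m : nat) (e : 'I_m -> V), forall x, X x ->
    exists c : 'I_m -> R[i], T x = \sum_(i < m) c i *: e i }.

Definition cb_norm (T : V -> V) : \bar R :=
  ereal_sup [set r | exists (n : nat) (x : 'M[V]_n),
    [/\ forall i j, X (x i j), (mnm x <= 1)%E & r = mnm (map_mx T x)]].

Definition directed (I : Type) (le : I -> I -> Prop) : Prop :=
  [/\ inhabited I,
      forall i, le i i,
      forall i j k, le i j -> le j k -> le i k &
      forall i j, exists k, le i k /\ le j k].

Definition cbap_constant (c : R) : Prop :=
  exists (I : Type) (le : I -> I -> Prop) (T : I -> V -> V),
  [/\ directed le,
      forall i, finite_rank_map (T i),
      forall i, (cb_norm (T i) <= c%:E)%E &
      forall x, X x -> forall e : R, 0 < e ->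
        exists i0, forall i, le i0 i -> (nm (T i x - x)%R < e%:E)%E].

(* the infimum is +oo if there is no such net *)
Definition haagerup_constant : \bar R :=
  ereal_inf [set c%:E | c in cbap_constant].

End HaagerupConstant.

Definition Lambda (R : realType) (A : cstarAlgebra R) : \bar R :=
  haagerup_constant [set: A] (fun a => (rnorm a)%:E) (@mxnorm R A).

(* The same constant for a C*-algebra given concretely, as a subset S of B(K):
   there the C*-norm of M_n(S) is the norm of B(K^n). *)
Definition Lambda_op (R : realType) (K : hilbertSpace R) (S : set (K -> K)) :
    \bar R :=
  haagerup_constant S (@opnorm R K) (@mxopnorm R K).

HB.mixin Record isTopologicalGroup G of Group G & PointedTopological G := {
  mulg_continuous : continuous (fun p : G * G => (p.1 * p.2)%g) ;
  invg_continuous : continuous (fun s : G => (s^-1)%g) }.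

#[short(type="topologicalGroupType")]
HB.structure Definition TopologicalGroup :=
  {G of isTopologicalGroup G & Group G & PointedTopological G}.

Notation borel G := (g_sigma_algebraType (@open G)).

Record left_haar_measure (R : realType) (G : topologicalGroupType)
    (mu : {measure set (borel G) -> \bar R}) : Prop := {
  haar_left_invariant : forall (s : G) (E : set (borel G)), measurable E ->
    mu [set (s * t)%g | t in (E : set G)] = mu E ;
  haar_compact : forall C : set G, compact C -> (mu C < +oo)%E ;
  haar_outer_regular : forall E : set (borel G), measurable E ->
    mu E = ereal_inf [set mu U | U in [set U : set G | open U /\ E `<=` U]] ;
  haar_inner_regular : forall U : set G, open U ->
    mu U = ereal_sup [set mu C | C in [set C : set G | compact C /\ C `<=` U]] ;
  haar_neq0 : mu [set: G] <> 0%E }.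

Record dynamical_system (R : realType) (A : cstarAlgebra R)
    (G : topologicalGroupType) (alpha : G -> A -> A) : Prop := {
  dyn_linear : forall t, linear (alpha t) ;
  dyn_mul : forall t a b, alpha t (cmul a b) = cmul (alpha t a) (alpha t b) ;
  dyn_star : forall t a, alpha t (cstar a) = cstar (alpha t a) ;
  dyn_bijective : forall t, bijective (alpha t) ;
  dyn_morphism : forall s t a, alpha (s * t)%g a = alpha s (alpha t a) ;
  dyn_continuous : forall a, continuous (fun t => alpha t a) }.

Definition Cc (R : realType) (G : topologicalType) (V : normedModType R[i])
    (f : G -> V) : Prop :=
  continuous f /\
  exists2 C : set G, compact C & forall t, ~ C t -> f t = 0.

Definition cintegral (R : realType) (G : topologicalGroupType)
    (mu : {measure set (borel G) -> \bar R}) (f : G -> R[i]) : R[i] :=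
  Rintegral mu setT (fun t : borel G => complex.Re (f t)) +i*
  Rintegral mu setT (fun t : borel G => complex.Im (f t)).

(* L^2(G, H) is the Hilbert space completion of C_c(G, H) for the inner product
   (xi, eta) |-> \int <xi t, eta t> dt, and is determined by this up to a unique
   unitary.  L2_class maps xi in C_c(G, H) to its class; its values at other
   functions are irrelevant. *)
Record L2space (R : realType) (G : topologicalGroupType)
    (mu : {measure set (borel G) -> \bar R}) (H : hilbertSpace R) := MkL2space {
  L2_car :> hilbertSpace R ;
  L2_class : (G -> H) -> L2_car ;
  L2_class_linear : forall (k : R[i]) (xi eta : G -> H), Cc xi -> Cc eta ->
    L2_class (k *: xi + eta) = k *: L2_class xi + L2_class eta ;
  L2_class_ip : forall xi eta : G -> H, Cc xi -> Cc eta ->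
    ip (L2_class xi) (L2_class eta) = cintegral mu (fun t => ip (xi t) (eta t)) ;
  L2_class_dense : forall (k : L2_car) (e : R), 0 < e ->
    exists2 xi : G -> H, Cc xi & rnorm (k - L2_class xi) < e }.

Section ReducedCrossedProduct.
Variables (R : realType) (A : cstarAlgebra R) (G : topologicalGroupType).
Variables (alpha : G -> A -> A) (mu : {measure set (borel G) -> \bar R}).
Variables (H : hilbertSpace R) (pi : A -> H -> H) (L2 : L2space mu H).

(* the bounded operator on L^2(G, H) that acts on C_c(G, H) by F *)
Definition L2_operator (F : (G -> H) -> G -> H) : L2 -> L2 :=
  get [set P : L2 -> L2 | bounded_op P /\
        forall xi, Cc xi -> P (L2_class L2 xi) = L2_class L2 (F xi)].

Definition tilde_pi (a : A) : L2 -> L2 :=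
  L2_operator (fun xi t => pi (alpha (t^-1)%g a) (xi t)).

Definition translation (s : G) : L2 -> L2 :=
  L2_operator (fun xi t => xi (s^-1 * t)%g).

(* the operator \int f(s) tilde_pi(a) lambda_s ds, as a weak integral *)
Definition integrated_op (f : G -> R[i]) (a : A) : L2 -> L2 :=
  get [set X : L2 -> L2 | bounded_op X /\
        forall x y, ip (X x) y =
          cintegral mu (fun s => f s * ip (tilde_pi a (translation s x)) y)].

Definition integrated_span : set (L2 -> L2) :=
  [set Y | exists (n : nat) (c : 'I_n -> R[i]) (f : 'I_n -> G -> R[i])
                  (a : 'I_n -> A),
     (forall i, Cc (f i : G -> R[i]^o)) /\
     Y = \sum_(i < n) c i *: integrated_op (f i) (a i)].

Definition reduced_crossed_product : set (L2 -> L2) :=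
  [set X | bounded_op X /\ forall e : R, 0 < e ->
     exists2 Y, integrated_span Y & (opnorm (X - Y)%R < e%:E)%E].

End ReducedCrossedProduct.

Arguments reduced_crossed_product {R A G} alpha {mu H} pi L2 _.

(* Main.v *)
(** Fix a probability density phi in C_c(G) and a real z in C_c(G) of L^2-norm 1.
    The map S a = \int phi(s) tilde_pi(a) lambda_s ds is completely contractive
    from A to the crossed product, since it is tilde_pi(a) times a contraction.
    With J h = z (x) h, an isometry from H to L^2(G, H), the compression
    X |-> J^* X J is completely contractive and maps the crossed product into
    pi(A): it sends \int f(s) tilde_pi(a) lambda_s ds to pi(b), where
    b = \int\int f(s) z(s^-1 t) z(t) alpha_{t^-1}(a) dt ds.  Calling T the resulting
    map to A, the element T (S a) is near a when z is supported near 1 and phi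
    is supported even nearer to 1.  If T_gamma approximates the identity of the
    crossed product, the maps T T_gamma S approximate that of A, with the same
    bound on the cb-norms.

    That pi(A) is closed, and that the norm of M_n(A) does not depend on the
    faithful representation, rests on the square root 1 - w of 1 - z for
    contractions z = z^*, where w is obtained by iterating w |-> (z + w^2) / 2. *)

Require Import Defs.
From mathcomp Require Import all_boot all_order all_algebra.
From mathcomp Require Import all_classical all_reals all_analysis.
From mathcomp Require Import measurable_realfun finmap.
From mathcomp Require Import complex zify ring lra.

Set Implicit Arguments.
Unset Strict Implicit.
Unset Printing Implicit Defensive.

Import Order.TTheory GRing.Theory Num.Theory.
Import numFieldNormedType.Exports.

Local Open Scope classical_set_scope.
Local Open Scope complex_scope.
Local Open Scope ring_scope.

(** [mxnorm] is a supremum over all faithful representations. The estimate for S uses it through the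
    representations [a |-> pi(alpha_{t^-1}(a))], one for each t, whereas the final maps are bounded
    only in [pi]; hence the need for independence of the representation. Isometry of [pi] gives more
    than closedness of pi(A): it makes the functionals [Re <pi(a) h, k>] norming on A, so that
    A-valued integrals, and with them the slices, exist in A itself.

    No spectral theory is used: a self-adjoint contraction is treated as the cosine of an angle, and
    double-angle formulas replace functional calculus.

    The operators on L^2(G, H) are picked by [get] from a specification. Each specification is
    therefore first shown to be satisfiable, by extension from C_c(G, H) or by a weak integral.

    phi and z depend on a finite subset of A and on a precision, so the net on A is indexed by such
    pairs, with one gamma chosen for each. *)

(** * Real-valued norms and limits with explicit error bounds *)

Section RealNorm.
Variables (R : realType) (V : normedModType R[i]).
Implicit Types x y : V.

Lemma rnormE x : `|x| = (rnorm x)%:C.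
Proof. by rewrite /rnorm RRe_real// ger0_real. Qed.

Lemma rnorm_ge0 x : 0 <= rnorm x.
Proof. by have := normr_ge0 x; rewrite rnormE ler0c. Qed.

Lemma rnorm0 : rnorm (0 : V) = 0.
Proof. by rewrite /rnorm normr0. Qed.

Lemma rnorm_eq0 x : rnorm x = 0 -> x = 0.
Proof. by move=> x0; apply/eqP; rewrite -normr_eq0 rnormE x0. Qed.

Lemma rnormN x : rnorm (- x) = rnorm x.
Proof. by rewrite /rnorm normrN. Qed.

Lemma rnormBC x y : rnorm (x - y) = rnorm (y - x).
Proof. by rewrite -rnormN opprB. Qed.

Lemma rnormD x y : rnorm (x + y) <= rnorm x + rnorm y.
Proof. by have := ler_normD x y; rewrite !rnormE -rmorphD lecR. Qed.

Lemma rnorm_triangle y x z : rnorm (x - z) <= rnorm (x - y) + rnorm (y - z).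
Proof. by rewrite -[x - z](subrKA y) rnormD. Qed.

Lemma rnormZ (k : R[i]) x : rnorm (k *: x) = complex.Re `|k| * rnorm x.
Proof. by rewrite {1}/rnorm normrZ (rnormE x) normc_def /= mulr0 subr0. Qed.

Lemma rnormZr (r : R) x : rnorm (r%:C *: x) = `|r| * rnorm x.
Proof. by rewrite rnormZ normc_def /= expr0n addr0 sqrtr_sqr. Qed.

Lemma rnorm_sum (I : Type) (s : seq I) (P : pred I) (F : I -> V) :
  rnorm (\sum_(i <- s | P i) F i) <= \sum_(i <- s | P i) rnorm (F i).
Proof.
elim/big_rec2: _ => [|i y1 y2 _ IH]; first by rewrite rnorm0.
by rewrite (le_trans (rnormD _ _))// lerD2l.
Qed.

Lemma cvg_rnormP (T : Type) (F : set_system T) {FF : Filter F} (f : T -> V) x :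
  f @ F --> x <-> forall e : R, 0 < e -> \forall t \near F, rnorm (x - f t) < e.
Proof.
split=> [/cvgrPdist_lt fx e e0|fx].
  have := fx e%:C; rewrite ltcR => /(_ e0); apply: filterS => t.
  by rewrite rnormE ltcR.
apply/cvgrPdist_lt => e e0; have er : e = (complex.Re e)%:C.
  by rewrite RRe_real// gtr0_real.
have := fx (complex.Re e); rewrite -ltcR -er => /(_ e0); apply: filterS => t.
by rewrite rnormE er ltcR.
Qed.

Lemma continuous_rnormP (T : topologicalType) (f : T -> V) :
  continuous f <->
  forall s (e : R), 0 < e -> \forall t \near s, rnorm (f s - f t) < e.
Proof. by split=> cf s; apply/cvg_rnormP/cf. Qed.

End RealNorm.

(** The Cauchy bound [d n] passes to the limit unchanged, so later estimates can compare with the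
    limit without choosing indices again. *)
Lemma rnorm_complete (R : realType) (V : completeNormedModType R[i])
    (u : nat -> V) (d : nat -> R) :
  (forall n m, (n <= m)%N -> rnorm (u m - u n) <= d n) ->
  d @ \oo --> (0 : R) ->
  exists l, forall n, rnorm (u n - l) <= d n.
Proof.
move=> ud d0.
have dsmall (e : R) : 0 < e -> \forall n \near \oo, d n < e.
  move=> e0; move/cvgr0Pnorm_lt : d0 => /(_ _ e0); apply: filterS => n.
  by apply: le_lt_trans; exact: ler_norm.
have : cvgn u.
  apply/cauchy_cvgP/cauchy_exP => e e0.
  have er : e = (complex.Re e)%:C by rewrite RRe_real// gtr0_real.
  have [N _ dN] := dsmall (complex.Re e) (ltac:(by rewrite -ltcR -er)).
  exists (u N), N => //= m Nm; rewrite -ball_normE /=.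
  rewrite rnormE er ltcR rnormBC (le_lt_trans (ud _ _ Nm))// dN//=.
move=> /cvg_ex[l /cvg_rnormP ul]; exists l => n.
apply/ler_addgt0Pr => e e0.
have [N _ uN] := ul _ e0.
pose m := maxn n N.
rewrite (le_trans (rnorm_triangle (u m) _ _))// lerD//.
  by rewrite rnormBC ud// leq_maxl.
by rewrite rnormBC ltW// uN//= leq_maxr.
Qed.

(** * Real inner products *)

Section RealForm.
Variables (R : realType) (E : lmodType R[i]).

(* The real part of an inner product; complex values are never needed, since
   [Im <x, y> = Re <x, i y>]. *)
Record real_form (g : E -> E -> R) : Prop := RealForm {
  rfDl : forall x y z, g (x + y) z = g x z + g y z ;
  rfZl : forall (r : R) x y, g (r%:C *: x) y = r * g x y ;
  rfC : forall x y, g x y = g y x ;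
  rf_ge0 : forall x, 0 <= g x x }.

Definition form_norm (g : E -> E -> R) (x : E) : R := Num.sqrt (g x x).

Variables (g : E -> E -> R) (gP : real_form g).
Implicit Types x y z : E.
Local Notation N := (form_norm g).

Lemma rfDr x y z : g x (y + z) = g x y + g x z.
Proof. by rewrite rfC// rfDl// !(rfC gP x). Qed.

Lemma rfZr (r : R) x y : g x (r%:C *: y) = r * g x y.
Proof. by rewrite rfC// rfZl// rfC. Qed.

Lemma rfNl x y : g (- x) y = - g x y.
Proof. by rewrite -scaleN1r -[-1](rmorphN1 (real_complex R)) rfZl// mulN1r. Qed.

Lemma rfNr x y : g x (- y) = - g x y.
Proof. by rewrite rfC// rfNl rfC. Qed.

Lemma rf0l y : g 0 y = 0.
Proof. by have /eqP := rfDl gP 0 0 y; rewrite addr0 -subr_eq subrr eq_sym => /eqP. Qed.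

Lemma rf_suml (I : Type) (s : seq I) (F : I -> E) y :
  g (\sum_(i <- s) F i) y = \sum_(i <- s) g (F i) y.
Proof. by elim/big_rec2: _ => [|i a b _ <-]; rewrite ?rf0l// rfDl. Qed.

Lemma form_norm_ge0 x : 0 <= N x.
Proof. exact: sqrtr_ge0. Qed.

Lemma sqr_form_norm x : N x ^+ 2 = g x x.
Proof. by rewrite sqr_sqrtr// rf_ge0. Qed.

Lemma form_normN x : N (- x) = N x.
Proof. by rewrite /form_norm rfNl rfNr opprK. Qed.

Lemma form_normZ (r : R) x : N (r%:C *: x) = `|r| * N x.
Proof.
by rewrite /form_norm rfZl// rfZr mulrA -expr2 sqrtrM ?sqr_ge0// sqrtr_sqr.
Qed.

Lemma rf_cauchy_schwarz x y : g x y <= N x * N y.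
Proof.
have sq : g x y ^+ 2 <= g x x * g y y.
  have key r : 0 <= g x x - 2 * r * g x y + r ^+ 2 * g y y.
    have := rf_ge0 gP (x - r%:C *: y).
    rewrite !(rfDl gP, rfDr, rfNl, rfNr, rfZl gP, rfZr) (rfC gP y x); nra.
  (* If [g y y = 0], [key] is affine in [r], and the [r] chosen below gives it the value -1;
     otherwise the minimizer [g x y / g y y] is used. *)
  have [y0|y0] := eqVneq (g y y) 0.
    rewrite y0 mulr0; have [->|xy0] := eqVneq (g x y) 0; first by rewrite expr0n.
    have := key ((g x x + 1) / (2 * g x y)); rewrite y0 mulr0 addr0.
    have -> : 2 * ((g x x + 1) / (2 * g x y)) * g x y = g x x + 1 by field.
    by lra.
  have yp : 0 < g y y by rewrite lt_neqAle eq_sym y0 rf_ge0.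
  have := key (g x y / g y y).
  have -> : g x x - 2 * (g x y / g y y) * g x y + (g x y / g y y) ^+ 2 * g y y =
            (g x x * g y y - g x y ^+ 2) / g y y by field.
  by rewrite pmulr_lge0 ?invr_gt0// subr_ge0.
rewrite (le_trans (ler_norm _))// -sqrtr_sqr -sqrtrM ?rf_ge0//.
by rewrite ler_wsqrtr.
Qed.

Lemma form_normD x y : N (x + y) <= N x + N y.
Proof.
rewrite -(ler_pXn2r (n := 2))// ?nnegrE ?addr_ge0 ?form_norm_ge0//.
rewrite sqrrD !sqr_form_norm rfDl// !rfDr (rfC gP y x).
by have := rf_cauchy_schwarz x y; lra.
Qed.

(** Take [y = x] and cancel. This turns bounds on pairings, which is what weak integrals provide,
    into bounds on norms. *)
Lemma form_norm_le x (M : R) : 0 <= M -> (forall y, g x y <= M * N y) -> N x <= M.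
Proof.
move=> M0 /(_ x); rewrite -sqr_form_norm expr2.
have [->//|x0] := eqVneq (N x) 0.
by rewrite ler_pM2r// lt_neqAle eq_sym x0 form_norm_ge0.
Qed.

End RealForm.

Definition ipr (R : realType) (H : hilbertSpace R) (x y : H) : R :=
  complex.Re (ip x y).

Section HilbertForm.
Variables (R : realType) (H : hilbertSpace R).
Implicit Types x y z : H.

Lemma iprZ (k : R[i]) x y :
  ipr (k *: x) y = complex.Re k * ipr x y - complex.Im k * ipr x ('i *: y).
Proof.
have ip0 z : ip 0 z = 0.
  have /eqP := ip_linearl 1 0 0 z.
  by rewrite scale1r addr0 mul1r -subr_eq subrr eq_sym => /eqP.
have ipZ (a : R[i]) (u v : H) : ip (a *: u) v = a * ip u v.
  by have := ip_linearl a u 0 v; rewrite addr0 ip0 addr0.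
rewrite /ipr ipZ (ip_conj ('i *: y)) ipZ (ip_conj x y).
by case: k (ip x y) => [a b] [c d] /=; ring.
Qed.

Lemma ipr_form : real_form (@ipr R H).
Proof.
split=> [x y z|r x y|x y|x].
- by rewrite /ipr -[x]scale1r ip_linearl mul1r scale1r; case: (ip x z) (ip y z) => ? ? [].
- by rewrite iprZ /= mul0r subr0.
- by rewrite /ipr (ip_conj y x); case: (ip y x).
- rewrite /ipr ip_norm rnormE -rmorphXn /=; exact: sqr_ge0.
Qed.

Lemma form_norm_ipr x : form_norm (@ipr R H) x = rnorm x.
Proof.
rewrite /form_norm /ipr ip_norm rnormE -rmorphXn/= sqrtr_sqr ger0_norm//.
exact: rnorm_ge0.
Qed.

Lemma ipr_norm x : ipr x x = rnorm x ^+ 2.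
Proof. by rewrite -form_norm_ipr sqr_form_norm//; exact: ipr_form. Qed.

Lemma ipr_le x y : ipr x y <= rnorm x * rnorm y.
Proof. by rewrite -!form_norm_ipr; exact/rf_cauchy_schwarz/ipr_form. Qed.

Lemma ipr_le_norm x (M : R) : 0 <= M ->
  (forall y, ipr x y <= M * rnorm y) -> rnorm x <= M.
Proof.
rewrite -form_norm_ipr => M0 xM; apply: (form_norm_le ipr_form M0) => y.
by rewrite form_norm_ipr.
Qed.

Lemma iprBl x y z : ipr (x - y) z = ipr x z - ipr y z.
Proof. by rewrite (rfDl ipr_form) (rfNl ipr_form). Qed.

Lemma ipr_inj x y : (forall z, ipr x z = ipr y z) -> x = y.
Proof.
move=> xy; apply/eqP; rewrite -subr_eq0; apply/eqP/rnorm_eq0/eqP.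
by rewrite -sqrf_eq0 -ipr_norm iprBl xy subrr.
Qed.

Lemma Im_ip x y : complex.Im (ip x y) = ipr x ('i *: y).
Proof.
have := iprZ (- 'i) x y; rewrite /ipr.
have -> : ip (- 'i *: x) y = - 'i * ip x y.
  have := ip_linearl (- 'i) x 0 y; rewrite addr0 => ->.
  have /eqP := ip_linearl 1 0 0 y.
  by rewrite scale1r addr0 mul1r -subr_eq subrr eq_sym => /eqP->; rewrite addr0.
by case: (ip x y) => a b /=; lra.
Qed.

End HilbertForm.

Section SumForm.
Variables (R : realType) (E : lmodType R[i]) (g : E -> E -> R).
Hypothesis gP : real_form g.
Variable n : nat.

Definition sum_form (v w : 'I_n -> E) : R := \sum_(i < n) g (v i) (w i).

Lemma sum_formP : real_form sum_form.
Proof.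
split=> [v w u|r v w|v w|v]; rewrite /sum_form.
- by rewrite -big_split/=; apply: eq_bigr => i _; rewrite -rfDl.
- by rewrite mulr_sumr; apply: eq_bigr => i _; rewrite -rfZl.
- by apply: eq_bigr => i _; rewrite rfC.
- by apply: sumr_ge0 => i _; rewrite rf_ge0.
Qed.

End SumForm.

Definition vnorm (R : realType) (H : hilbertSpace R) n (v : 'I_n -> H) : R :=
  form_norm (sum_form (@ipr R H) (n := n)) v.

Section VectorNorm.
Variables (R : realType) (H : hilbertSpace R) (n : nat).
Implicit Types v w : 'I_n -> H.

Definition vform := sum_formP (@ipr_form R H) n.

Lemma vnormE v : vnorm v = Num.sqrt (\sum_(i < n) rnorm (v i) ^+ 2).
Proof. by congr Num.sqrt; apply: eq_bigr => i _; rewrite ipr_norm. Qed.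

Lemma sqr_vnorm v : vnorm v ^+ 2 = \sum_(i < n) rnorm (v i) ^+ 2.
Proof. by rewrite vnormE sqr_sqrtr// sumr_ge0// => i _; rewrite sqr_ge0. Qed.

Lemma vnorm_ge0 v : 0 <= vnorm v.
Proof. exact: form_norm_ge0. Qed.

Lemma rnorm_le_vnorm v i : rnorm (v i) <= vnorm v.
Proof.
rewrite -(ler_pXn2r (n := 2))// ?nnegrE ?vnorm_ge0 ?rnorm_ge0// sqr_vnorm.
by rewrite (bigD1 i)//= lerDl sumr_ge0// => j _; rewrite sqr_ge0.
Qed.

Lemma vnorm_le_sum v : vnorm v <= \sum_(i < n) rnorm (v i).
Proof.
have S0 : 0 <= \sum_(i < n) rnorm (v i) by apply: sumr_ge0 => i _; exact: rnorm_ge0.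
rewrite -(ler_pXn2r (n := 2))// ?nnegrE ?vnorm_ge0// sqr_vnorm expr2 mulr_suml.
apply: ler_sum => i _; rewrite expr2 ler_wpM2l ?rnorm_ge0//.
by rewrite (bigD1 i)//= lerDl sumr_ge0// => j _; exact: rnorm_ge0.
Qed.

End VectorNorm.

(** * Square roots by iteration *)

(** The speed at which the scalar iteration below approaches 1; it also serves as the generic null
    sequence of all later approximations. *)
Definition rate (R : realType) (n : nat) : R := 2 / n.+2%:R.

Lemma rate_cvg0 (R : realType) : rate R @ \oo --> (0 : R).
Proof.
apply/cvgrPdist_lt => e e0; near=> n.
rewrite sub0r normrN ger0_norm ?divr_ge0// ltr_pdivrMr ?ltr0n// mulrC.
rewrite -ltr_pdivrMr//; apply: (@lt_le_trans _ _ n%:R); last by rewrite ler_nat; lia.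
near: n; exact: nbhs_infty_gtr.
Unshelve. all: by end_near.
Qed.

Section SqrtIteration.
Variables (R : realType) (V : zmodType) (mul : V -> V -> V) (half : V -> V).
Hypothesis halfB : {morph half : x y / x - y}.
Hypothesis mulDl : forall a b c, mul (a + b) c = mul a c + mul b c.
Hypothesis mulDr : forall a b c, mul a (b + c) = mul a b + mul a c.

(* If [w] is the limit, [2 w = z + w^2], that is [(1 - w)^2 = 1 - z]; the scalar
   iteration [sqrt_iter1] with [z = 1] majorizes all others with [|z| <= 1]. *)
Fixpoint sqrt_iter (z : V) (n : nat) : V :=
  if n is m.+1 then
    half (z + mul (sqrt_iter z m) (sqrt_iter z m))
  else 0.

Fixpoint sqrt_iter1 (n : nat) : R :=
  if n is m.+1 then 2^-1 * (1 + sqrt_iter1 m ^+ 2) else 0.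

(** The gap [u = 1 - t] evolves by [u |-> u (1 - u / 2)], which is increasing on [0, 1] and sends
    [2 / x] to [2 (x - 1) / x^2 <= 2 / (x + 1)]. *)
Lemma sqrt_iter1_bounds n :
  [/\ 0 <= sqrt_iter1 n, sqrt_iter1 n <= 1 & 1 - sqrt_iter1 n <= rate R n].
Proof.
rewrite /rate.
elim: n => [|n [t0 t1 tn]] /=.
  by rewrite subr0 divff//; split.
set t := sqrt_iter1 n in t0 t1 tn *; split; [nra|nra|].
pose x : R := n.+2%:R; have x2 : 2 <= x by rewrite ler_nat.
have xp : 0 < x by lra.
have tx : (1 - t) * x <= 2 by rewrite -ler_pdivlMr.
rewrite (_ : n.+3%:R = x + 1); last by rewrite -[n.+3]addn1 natrD.
rewrite ler_pdivlMr; last lra.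
have t1x : 1 - t <= 2 / x by rewrite ler_pdivlMr.
have x1 : 2 / x <= 1 by rewrite ler_pdivrMr// mul1r.
have e2 : (1 - t) * (1 - (1 - t) / 2) <= 2 / x * (1 - 2 / x / 2).
  set u := 1 - t in t1x *; set y := 2 / x in t1x x1 *.
  have u0 : 0 <= u by rewrite /u; lra.
  nra.
have -> : 1 - 2^-1 * (1 + t ^+ 2) = (1 - t) * (1 - (1 - t) / 2) by field.
rewrite (le_trans (ler_wpM2r _ e2))//; first lra.
have -> : 2 / x * (1 - 2 / x / 2) * (x + 1) = 2 * ((x ^+ 2 - 1) / x ^+ 2).
  by field; lra.
rewrite -[leRHS]mulr1 ler_wpM2l// ler_pdivrMr ?exprn_gt0// mul1r; lra.
Qed.

(* [B x r] stands for [|x| <= r]; a relation, so that matrices over a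
   C*-algebra need not be normed. *)
Variable B : V -> R -> Prop.
Hypothesis B0 : B 0 0.
Hypothesis BD : forall x y r s, B x r -> B y s -> B (x + y) (r + s).
Hypothesis BM : forall x y r s, B x r -> B y s -> B (mul x y) (r * s).
Hypothesis BZ : forall x r, B x r -> B (half x) (2^-1 * r).
Variable z : V.
Hypothesis Bz : B z 1.
Local Notation w := (sqrt_iter z).
Local Notation t := sqrt_iter1.

Lemma sqrt_iter_bounded n : B (w n) (t n).
Proof. by elim: n => [|n IH] //=; apply/BZ/BD => //; rewrite expr2; exact: BM. Qed.

(** Writing [a^2 - b^2 = a (a - b) + (a - b) b] needs no commutativity, and the scalar increments
    obey the same recursion. *)
Lemma sqrt_iter_step n : B (w n.+1 - w n) (t n.+1 - t n).
Proof.
have mul0l c : mul 0 c = 0.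
  have /eqP := mulDl 0 0 c.
  by rewrite addr0 -subr_eq subrr eq_sym => /eqP.
elim: n => [|n IH].
  by rewrite /= mul0l addr0 subr0 subr0 expr0n/=; apply: BZ; rewrite addr0.
have -> : w n.+2 - w n.+1 = half
    (mul (w n.+1) (w n.+1 - w n) + mul (w n.+1 - w n) (w n)).
  have mulBr a b c : mul a (b - c) = mul a b - mul a c.
    by apply/eqP; rewrite eq_sym subr_eq -mulDr subrK.
  have mulBl a b c : mul (a - b) c = mul a c - mul b c.
    by apply/eqP; rewrite eq_sym subr_eq -mulDl subrK.
  have wS k : w k.+1 = half (z + mul (w k) (w k)) by [].
  rewrite mulBr mulBl subrKA (wS n.+1) [X in _ - X]wS -halfB.
  by rewrite opprD addrACA subrr add0r.
have -> : t n.+2 - t n.+1 = 2^-1 * (t n.+1 * (t n.+1 - t n) + (t n.+1 - t n) * t n).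
  have tS k : t k.+1 = 2^-1 * (1 + t k ^+ 2) by [].
  by rewrite (tS n.+1) [X in _ - X]tS; ring.
by apply/BZ/BD; apply: BM => //; exact: sqrt_iter_bounded.
Qed.

Lemma sqrt_iter_diff n m : (n <= m)%N -> B (w m - w n) (t m - t n).
Proof.
move=> /subnK <-; elim: (m - n)%N => [|k IH]; first by rewrite !subrr.
rewrite addSn -[X in B X](subrKA (w (k + n))) -[X in B _ X](subrKA (t (k + n))).
by apply: BD => //; exact: sqrt_iter_step.
Qed.

End SqrtIteration.

(** The common last step of the density and limit arguments: an error that is [O(1/n)] for every n
    is not positive. *)
Lemma le_rate0 (R : realType) (r C : R) :
  (forall n, r <= C * rate R n) -> r <= 0.
Proof.
rewrite /rate.
move=> rC; apply/ler_addgt0Pr => e e0; rewrite add0r.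
have C0 : 0 <= `|C| by [].
pose n := Num.bound (2 * `|C| / e).
have nb : 2 * `|C| / e < n.+2%:R.
  have x0 : 0 <= 2 * `|C| / e by rewrite divr_ge0 ?mulr_ge0// ltW.
  by apply: (lt_le_trans (archi_boundP x0)); rewrite ler_nat; lia.
rewrite (le_trans (rC n))// (@le_trans _ _ (`|C| * (2 / n.+2%:R)))//.
  by rewrite ler_wpM2r// ?divr_ge0// ler_norm.
rewrite mulrA ler_pdivrMr ?ltr0n//.
by move: nb; rewrite ltr_pdivrMr// mulrC => /ltW; rewrite [e * _]mulrC.
Qed.

(** * Square roots in a C*-algebra without unit *)

Section CstarAlgebra.
Variables (R : realType) (A : cstarAlgebra R).
Implicit Types a b c : A.

Lemma cmulDl a b c : cmul (a + b) c = cmul a c + cmul b c.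
Proof. by have := cmul_linearl 1 a b c; rewrite !scale1r. Qed.
Lemma cmulDr a b c : cmul a (b + c) = cmul a b + cmul a c.
Proof. by have := cmul_linearr 1 a b c; rewrite !scale1r. Qed.
Lemma cmulBl a b c : cmul (a - b) c = cmul a c - cmul b c.
Proof. by apply/eqP; rewrite eq_sym subr_eq -cmulDl subrK. Qed.
Lemma cmulBr a b c : cmul a (b - c) = cmul a b - cmul a c.
Proof. by apply/eqP; rewrite eq_sym subr_eq -cmulDr subrK. Qed.
Lemma cmul0l c : cmul 0 c = 0.
Proof. by have := cmulBl 0 0 c; rewrite !subrr. Qed.
Lemma cmul0r c : cmul c 0 = 0.
Proof. by have := cmulBr c 0 0; rewrite !subrr. Qed.
Lemma cmulZl k a b : cmul (k *: a) b = k *: cmul a b.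
Proof. by have := cmul_linearl k a 0 b; rewrite cmul0l !addr0. Qed.
Lemma cmulZr k a b : cmul a (k *: b) = k *: cmul a b.
Proof. by have := cmul_linearr k a b 0; rewrite cmul0r !addr0. Qed.

Lemma cstarD a b : cstar (a + b) = cstar a + cstar b.
Proof. by have := cstar_antilinear 1 a b; rewrite rmorph1 !scale1r. Qed.
Lemma cstarB a b : cstar (a - b) = cstar a - cstar b.
Proof. by apply/eqP; rewrite eq_sym subr_eq -cstarD subrK. Qed.
Lemma cstar0 : cstar (0 : A) = 0.
Proof. by have := cstarB 0 0; rewrite !subrr. Qed.
Lemma cstarZ k a : cstar (k *: a) = k^* *: cstar a.
Proof. by have := cstar_antilinear k a 0; rewrite cstar0 !addr0. Qed.
Lemma cstarZr (r : R) a : cstar (r%:C *: a) = r%:C *: cstar a.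
Proof. by rewrite cstarZ (conjc_real r : (r%:C)^* = _). Qed.

Lemma rnorm_cmul a b : rnorm (cmul a b) <= rnorm a * rnorm b.
Proof. by have := cnormM a b; rewrite !rnormE -rmorphM lecR. Qed.

Lemma rnorm_cstar_cmul a : rnorm (cmul (cstar a) a) = rnorm a ^+ 2.
Proof. by have := cnorm_cstar a; rewrite !rnormE -rmorphXn => /complexI. Qed.

Lemma rnorm_cstar a : rnorm (cstar a) = rnorm a.
Proof.
have le b : rnorm b <= rnorm (cstar b).
  have := rnorm_cmul (cstar b) b; rewrite rnorm_cstar_cmul expr2.
  have [->|b0] := eqVneq (rnorm b) 0; first by rewrite rnorm_ge0.
  by rewrite ler_pM2r// lt_neqAle eq_sym b0 rnorm_ge0.
by apply/eqP; rewrite eq_le le -{2}[a]cstarK le.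
Qed.

(* With [w] written [1 - v] in the unitization, [v] is the square root of
   [1 - z]. *)
Lemma cstar_sqrt (z : A) : cstar z = z -> rnorm z <= 1 ->
  exists w, [/\ cstar w = w, rnorm w <= 1, w + w = z + cmul w w &
    forall x, cmul z x = cmul x z -> cmul w x = cmul x w].
Proof.
move=> zs z1; pose half : A -> A := *:%R (2^-1 : R)%:C.
have halfB : {morph half : x y / x - y} by move=> x y; rewrite /half scalerBr.
pose W := sqrt_iter (@cmul R A) half z.
pose B (x : A) (r : R) := rnorm x <= r.
have BD x y r s : B x r -> B y s -> B (x + y) (r + s).
  by move=> xr ys; rewrite /B (le_trans (rnormD _ _))// lerD.
have BM x y r s : B x r -> B y s -> B (cmul x y) (r * s).
  by move=> xr ys; rewrite /B (le_trans (rnorm_cmul _ _))// ler_pM ?rnorm_ge0.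
have BZ x r : B x r -> B ((2^-1 : R)%:C *: x) (2^-1 * r).
  by rewrite /B rnormZr ger0_norm// ler_pM2l.
have B0 : B 0 0 by rewrite /B rnorm0.
have Wdiff n m : (n <= m)%N -> rnorm (W m - W n) <= rate R n.
  move=> nm; have := sqrt_iter_diff halfB cmulDl cmulDr B0 BD BM BZ z1 nm.
  rewrite /B => /le_trans; apply.
  have [_ tm _] := sqrt_iter1_bounds R m; have [_ _ tn] := sqrt_iter1_bounds R n.
  by lra.
have W1 n : rnorm (W n) <= 1.
  have := sqrt_iter_bounded B0 BD BM BZ z1 n; rewrite /B => /le_trans; apply.
  by have [] := sqrt_iter1_bounds R n.
have [|w Ww] := rnorm_complete Wdiff.
  exact: rate_cvg0.
have wW n : rnorm (w - W n) <= rate R n by rewrite rnormBC.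
have w1 : rnorm w <= 1.
  rewrite -subr_le0; apply: (le_rate0 (C := 1)) => n; rewrite mul1r.
  have := rnormD (w - W n) (W n); rewrite subrK.
  by have := wW n; have := W1 n; lra.
have eq0 (x : A) (C : R) : (forall n, rnorm x <= C * rate R n) -> x = 0.
  move=> xC; apply/rnorm_eq0/eqP; rewrite eq_le rnorm_ge0 andbT.
  exact: le_rate0 xC.
exists w; split => //.
- apply/eqP; rewrite -subr_eq0; apply/eqP/(eq0 _ 2) => n.
  have Wn : cstar (W n) = W n.
    elim: n => [|n IH]; first exact: cstar0.
    by rewrite /= cstarZr cstarD cstarM IH zs.
  apply: (le_trans (rnorm_triangle (W n) _ _)); rewrite -{1}Wn -cstarB rnorm_cstar.
  by have := wW n; have := Ww n; lra.
(* The defect of the equation is compared with [2 W_{n+1} = z + W_n^2]: two differences to [W n.+1]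
   and two products containing [W n - w] account for the 4. *)
- apply/eqP; rewrite -subr_eq0; apply/eqP/(eq0 _ 4) => n.
  have Wn : W n.+1 + W n.+1 = z + cmul (W n) (W n).
    by rewrite -scalerDl -rmorphD/= (_ : 2^-1 + 2^-1 = 1 :> R) ?scale1r//; field.
  have -> : w + w - (z + cmul w w) = (w - W n.+1) + (w - W n.+1) +
      (cmul (W n) (W n - w) + cmul (W n - w) w).
    rewrite cmulBr cmulBl subrKA [(w - _) + _]addrACA -opprD Wn.
    by rewrite -[RHS]addrA; congr +%R; rewrite !opprD subrKA.
  have dn : rate R n.+1 <= rate R n.
    by rewrite ler_wpM2l// lef_pV2 ?posrE ?ltr0n// ler_nat.
  have h1 : rnorm (cmul (W n) (W n - w)) <= rate R n.
    rewrite (le_trans (rnorm_cmul _ _))//.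
    by rewrite (le_trans (ler_pM _ _ (W1 n) (Ww n))) ?rnorm_ge0// mul1r.
  have h2 : rnorm (cmul (W n - w) w) <= rate R n.
    rewrite (le_trans (rnorm_cmul _ _))//.
    by rewrite (le_trans (ler_pM _ _ (Ww n) w1)) ?rnorm_ge0// mulr1.
  have := rnormD (w - W n.+1 + (w - W n.+1)) (cmul (W n) (W n - w) + cmul (W n - w) w).
  have := rnormD (w - W n.+1) (w - W n.+1).
  have := rnormD (cmul (W n) (W n - w)) (cmul (W n - w) w).
  by have := wW n.+1; lra.
(* The iterates are polynomials in [z], so they commute with whatever commutes with [z], and so does
   their limit. *)
- move=> x zx; apply/eqP; rewrite -subr_eq0; apply/eqP/(eq0 _ (2 * rnorm x)) => n.
  have Wn : cmul (W n) x = cmul x (W n).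
    elim: n => [|n IH]; first by rewrite cmul0l cmul0r.
    by rewrite /= cmulZl cmulZr cmulDl cmulDr -zx -cmulA IH cmulA IH -cmulA.
  have -> : cmul w x - cmul x w = cmul (w - W n) x + cmul x (W n - w).
    by rewrite cmulBl cmulBr Wn subrKA.
  apply: (le_trans (rnormD _ _)).
  have := rnorm_cmul (w - W n) x; have := rnorm_cmul x (W n - w).
  have := wW n; have := Ww n; have := rnorm_ge0 x; nra.
Qed.

End CstarAlgebra.

(** * Faithful representations are isometric *)

Section LinearMaps.
Variables (R : realType) (V W : lmodType R[i]) (P : V -> W).
Hypothesis Plin : linear P.

Lemma linD x y : P (x + y) = P x + P y.
Proof. by have := Plin 1 x y; rewrite !scale1r. Qed.
Lemma linB x y : P (x - y) = P x - P y.
Proof. by apply/eqP; rewrite eq_sym subr_eq -linD subrK. Qed.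
Lemma lin0 : P 0 = 0.
Proof. by have := linB 0 0; rewrite !subrr. Qed.
Lemma linZ k x : P (k *: x) = k *: P x.
Proof. by have := Plin k x 0; rewrite lin0 !addr0. Qed.
Lemma lin_sum (I : Type) (s : seq I) (F : I -> V) :
  P (\sum_(i <- s) F i) = \sum_(i <- s) P (F i).
Proof. by elim/big_rec2: _ => [|i a b _ <-]; rewrite ?lin0 ?linD. Qed.

End LinearMaps.

Section Representation.
Variables (R : realType) (A : cstarAlgebra R) (H : hilbertSpace R).
Variables (sigma : A -> H -> H).
Hypothesis sP : star_representation sigma.
Implicit Types (a b : A) (h k : H).

Lemma srepL a : linear (sigma a).
Proof. by have [] := srep_bounded sP a. Qed.
Lemma srepD a b h : sigma (a + b) h = sigma a h + sigma b h.
Proof. by rewrite (linD (srep_linear sP)). Qed.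
Lemma srepB a b h : sigma (a - b) h = sigma a h - sigma b h.
Proof. by rewrite (linB (srep_linear sP)). Qed.
Lemma srepZ (l : R[i]) a h : sigma (l *: a) h = l *: sigma a h.
Proof. by rewrite (linZ (srep_linear sP)). Qed.
Lemma srep0 h : sigma 0 h = 0.
Proof. by rewrite (lin0 (srep_linear sP)). Qed.
Lemma srepM a b h : sigma (cmul a b) h = sigma a (sigma b h).
Proof. by rewrite (srep_mul sP). Qed.
Lemma srep_starl a h k : ipr (sigma (cstar a) h) k = ipr h (sigma a k).
Proof. by rewrite /ipr (srep_star sP). Qed.

(* [|h|^2 - |sigma a h|^2 = |h - sigma w h|^2] when [(1 - w)^2 = 1 - a^* a]. *)
Lemma srep_contractive a h : rnorm (sigma a h) <= rnorm a * rnorm h.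
Proof.
have contr b : rnorm b <= 1 -> rnorm (sigma b h) <= rnorm h.
  move=> b1; have [||w [ws _ ww _]] := @cstar_sqrt R A (cmul (cstar b) b).
  - by rewrite cstarM cstarK.
  - by rewrite rnorm_cstar_cmul expr_le1// rnorm_ge0.
  rewrite -(ler_pXn2r (n := 2))// ?nnegrE ?rnorm_ge0// -!ipr_norm.
  have := congr1 (fun x => ipr (sigma x h) h) ww.
  rewrite /= !srepD !srepM !(rfDl (ipr_form H)) srep_starl -{3}ws srep_starl.
  have := rf_ge0 (ipr_form H) (h - sigma w h).
  rewrite !iprBl !(rfDr (ipr_form H)) !(rfNr (ipr_form H)) (rfC (ipr_form H) h (sigma w h)).
  by lra.
have [a0|a0] := eqVneq (rnorm a) 0.
  by rewrite (rnorm_eq0 a0) srep0 !rnorm0 mul0r.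
have ap : 0 < rnorm a by rewrite lt_neqAle eq_sym a0 rnorm_ge0.
have := contr ((rnorm a)^-1%:C *: a).
rewrite srepZ !rnormZr ger0_norm ?invr_ge0 ?rnorm_ge0// mulVf// => /(_ (lexx _)).
by rewrite ler_pdivrMl.
Qed.

End Representation.

Section Isometry.
Variables (R : realType) (A : cstarAlgebra R) (H : hilbertSpace R).
Variables (pi : A -> H -> H).
Hypothesis piP : faithful_rep pi.
Implicit Types (a b c : A) (h k : H).

Let sP : star_representation pi := piP.1.

(** For [p = (cos t) x] and [q = (sin t) x] this says that [cos t + i sin t] and its adjoint act
    isometrically. The cross terms of [(p + e q)^* (p + e q)] cancel for [e = i] and [e = -i]; the
    C*-identity does the rest. *)
Lemma rnorm_trig (x p q : A) :
  cmul (cstar p) p + cmul (cstar q) q = cmul (cstar x) x ->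
  cmul (cstar p) q = cmul (cstar q) p ->
  rnorm (p + 'i *: q) = rnorm x /\ rnorm (p - 'i *: q) = rnorm x.
Proof.
move=> pq pqc.
have main (e : R[i]) : e^* = - e -> e * e = -1 -> rnorm (p + e *: q) = rnorm x.
  move=> es ee; apply/eqP; rewrite -(eqrXn2 (n := 2))// ?rnorm_ge0//.
  rewrite -!rnorm_cstar_cmul cstarD cstarZ es !(cmulDl, cmulDr) !(cmulZl, cmulZr).
  rewrite pqc !scalerA mulNr ee opprK scale1r addrA -(addrA (cmul (cstar p) p)).
  by rewrite -scalerDl subrr scale0r addr0 pq.
have ii : 'i * 'i = -1 :> R[i] by rewrite -expr2 sqrCi.
split; first by apply: main => //; exact: conjCi.
rewrite -scaleNr; apply: main; last by rewrite mulrNN.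
have ic : ('i : R[i])^* = - 'i by exact: conjCi.
by rewrite rmorphN/= ic.
Qed.

(* With [c = cos t], the element [g] below is [max 0 (2 (cos 2t))]: it is killed
   by [pi], and being zero forces [2 c^2] to be a contraction. *)
Lemma faithful_half (c : A) : cstar c = c -> rnorm c <= 1 ->
  (forall h, 2 * ipr (pi c h) (pi c h) <= ipr h h) -> 2 * rnorm c ^+ 2 <= 1.
Proof.
move=> cs c1 pc.
have [||w1 [w1s w1n w1e w1c]] := @cstar_sqrt R A (cmul c c).
- by rewrite cstarM cs.
- by rewrite -{1}cs rnorm_cstar_cmul expr_le1// rnorm_ge0.
have cw : cmul c w1 = cmul w1 c by rewrite -w1c// cmulA.
(* [q] is multiplication by [sin t = 1 - w1], an element of the unitization only; [qq] below says
   [sin^2 t = 1 - cos^2 t]. *)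
pose q x := x - cmul w1 x.
have qlin x y : q (x + y) = q x + q y by rewrite /q cmulDr opprD addrACA.
have qZ (k : R[i]) x : q (k *: x) = k *: q x by rewrite /q cmulZr -scalerBr.
have qq x : q (q x) = x - cmul (cmul c c) x.
  have := congr1 (fun y => cmul y x) w1e; rewrite /= !cmulDl => e.
  have -> : cmul (cmul c c) x = cmul w1 x + cmul w1 x - cmul (cmul w1 w1) x.
    by rewrite e addrK.
  rewrite /q cmulBr cmulA !opprB -addrA; congr +%R.
  by rewrite addrCA -opprD.
have qc x : cmul c (q x) = q (cmul c x).
  by rewrite /q cmulBr !cmulA cw.
have qs x y : cmul (cstar (q x)) y = cmul (cstar x) (q y).
  by rewrite /q cstarB cstarM w1s cmulBl cmulBr cmulA.
have csl x y : cmul (cstar (cmul c x)) y = cmul (cstar x) (cmul c y).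
  by rewrite cstarM cs cmulA.
have trig x : rnorm (cmul c x + 'i *: q x) = rnorm x /\
              rnorm (cmul c x - 'i *: q x) = rnorm x.
  apply: rnorm_trig; rewrite csl qs; last by rewrite qc.
  by rewrite qq -cmulDr cmulA subrKC.
(* [s] is [sin 2t = 2 sin t cos t], which lies in the algebra itself. *)
pose r := q c; pose s := r + r.
have rs : cstar r = r by rewrite cstarB cstarM w1s cs cw.
have ss : cstar s = s by rewrite cstarD rs.
(* With [y = e^{it} x] and [z = e^{-it} x], the difference of [e^{it} y] and [e^{-it} z] is
   [2 i (sin 2t) x], while both have the norm of [x]. *)
have sle x : rnorm (cmul s x) <= rnorm x.
  pose y := cmul c x + 'i *: q x; pose z := cmul c x - 'i *: q x.
  have rE : cmul r x = cmul c (q x) by rewrite qc /r /q cmulBl cmulA.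
  have yz : (cmul c y + 'i *: q y) - (cmul c z - 'i *: q z) =
      'i *: (cmul s x + cmul s x).
    have UV (a b : A) : cmul c a + 'i *: q a - (cmul c b - 'i *: q b) =
        cmul c (a - b) + 'i *: q (a + b).
      by rewrite qlin cmulBr opprB [X in _ + X = _]addrC addrACA -scalerDr.
    rewrite UV; have -> : y - z = 'i *: (q x + q x).
      by rewrite /y /z opprB addrC subrKA -scalerDr.
    have -> : y + z = cmul c x + cmul c x by rewrite /y /z addrACA subrr addr0.
    by rewrite cmulZr -scalerDr cmulDr qlin -qc /s cmulDl rE.
  have := rnormD (cmul c y + 'i *: q y) (- (cmul c z - 'i *: q z)).
  rewrite yz rnormN (trig y).1 (trig z).2 (trig x).1 (trig x).2.
  rewrite rnormZ normCi /= mul1r.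
  rewrite -[cmul s x + _]mulr2n -scaler_nat -(rmorph_nat (real_complex R)) rnormZr.
  by rewrite ger0_norm//; lra.
have s1 : rnorm s <= 1.
  have := sle s; rewrite -{1}ss rnorm_cstar_cmul expr2.
  have [->//|s0] := eqVneq (rnorm s) 0.
  by rewrite ger_pMl// lt_neqAle eq_sym s0 rnorm_ge0.
(* Now [1 - w] is [|cos 2t|]. Since [d] is [1 + cos 2t], the element [g = d - w] is the sum of
   [cos 2t] and its absolute value. *)
have [||w [ws wn we wc]] := @cstar_sqrt R A (cmul s s).
- by rewrite cstarM ss.
- by rewrite -{1}ss rnorm_cstar_cmul expr_le1// rnorm_ge0.
pose d := cmul c c + cmul c c; pose g := d - w.
have gs : cstar g = g by rewrite cstarB cstarD cstarM cs ws.
have ssE : cmul s s = (d + d) - cmul d d.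
  have -> : cmul s s = (cmul r r + cmul r r) + (cmul r r + cmul r r).
    by rewrite cmulDl !cmulDr.
  have -> : cmul r r = cmul c c - cmul (cmul c c) (cmul c c).
    by rewrite -{1}rs {1}/r qs cs qq cmulBr !cmulA.
  rewrite /d cmulDl !cmulDr ![_ - _ + (_ - _)]addrACA -!opprD.
  by rewrite addrACA -!opprD.
have wdc : cmul w d = cmul d w.
  by apply: wc; rewrite ssE cmulBl cmulBr cmulDl cmulDr !cmulA.
(* [w + d] equals [2 + cos 2t - |cos 2t|], which is 2 wherever [g] does not vanish. *)
have key : cmul (w + d) g = g + g.
  rewrite cmulDl !cmulBr wdc addrC addrA subrK.
  have -> : cmul w w = w + w - cmul s s by rewrite we addrC addKr.
  by rewrite ssE opprB addrA subrKC opprD addrACA.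
have dE : d = cmul c c + cmul c c by [].
have gE : g = d - w by [].
clearbody d g.
have g0 : g = 0.
  apply: piP.2; apply/funext => h; rewrite srep0//.
  pose xi := pi g h.
  have cc k : ipr (pi c (pi c k)) k = ipr (pi c k) (pi c k).
    by rewrite -{1}cs (srep_starl sP).
  (* Each summand is at most [|xi|^2], by [wle] and [pc], so both attain it. Equality in
     Cauchy-Schwarz then makes [xi] a fixed vector of [pi w] and of [pi d], hence [pi g xi = 0]. *)
  have e1 : ipr (pi w xi) xi + 2 * ipr (pi c xi) (pi c xi) = 2 * ipr xi xi.
    have := congr1 (fun x => ipr (pi x h) xi) key.
    rewrite /= (srepM sP) !(srepD sP) -/xi dE (srepD sP) !(rfDl (ipr_form H)) (srepM sP) cc.
    by lra.
  have wle k : ipr (pi w k) (pi w k) <= ipr k k.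
    rewrite !ipr_norm ler_pXn2r ?nnegrE ?rnorm_ge0//.
    apply: (le_trans (srep_contractive sP _ _)).
    by rewrite -[leRHS]mul1r ler_wpM2r ?rnorm_ge0.
  have sq0 k : ipr k k <= 0 -> k = 0.
    rewrite ipr_norm => k0; apply/rnorm_eq0/eqP.
    by rewrite -sqrf_eq0 eq_le k0 sqr_ge0.
  have sqB k l : ipr (k - l) (k - l) = ipr k k - 2 * ipr k l + ipr l l.
    rewrite iprBl !(rfDr (ipr_form H)) !(rfNr (ipr_form H)) (rfC (ipr_form H) l k).
    by ring.
  have w0 : pi w xi - xi = 0.
    apply: sq0; have := sqB (pi w xi) xi; have := sqB xi (pi w xi).
    have := rf_ge0 (ipr_form H) (xi - pi w xi); rewrite (rfC (ipr_form H) xi (pi w xi)).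
    have := wle xi; have := pc xi; lra.
  have d0 : pi d xi - xi = 0.
    apply: sq0; have := sqB (pi d xi) xi; rewrite dE !(srepD sP) (srepM sP).
    rewrite !(rfDl (ipr_form H)) !(rfDr (ipr_form H)) cc.
    have := pc (pi c xi).
    have := wle xi; have := pc xi; have := congr1 (fun k => ipr k xi) w0.
    rewrite /= iprBl (rf0l (ipr_form H)); lra.
  apply: sq0.
  have -> : ipr (pi g h) (pi g h) = ipr (pi g xi) h.
    by rewrite -{3}gs (srep_starl sP).
  by rewrite gE (srepB sP) -(subrK xi (pi d xi)) -(subrK xi (pi w xi)) d0 w0 subrr (rf0l (ipr_form H)).
have wd : w = d by apply/eqP; rewrite eq_sym -subr_eq0 -gE g0.
have := wn; rewrite wd dE -mulr2n -scaler_nat -(rmorph_nat (real_complex R)) rnormZr.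
by rewrite ger0_norm// -{1}cs rnorm_cstar_cmul.
Qed.

(** After scaling, [faithful_half] improves a bound [K >= sqrt 2 M] on the norm of [b] to
    [K / sqrt 2]. Taking [K = |b|] excludes [|b| > sqrt 2 M], and then [K = sqrt 2 M] gives the
    claim. *)
Lemma faithful_selfadjoint_le (b : A) (M : R) : cstar b = b -> 0 < M ->
  (forall h, rnorm (pi b h) <= M * rnorm h) -> rnorm b <= M.
Proof.
move=> bs M0 bM.
have scaled (K : R) : 0 < K -> 2 * M ^+ 2 <= K ^+ 2 -> rnorm b <= K ->
    2 * rnorm b ^+ 2 <= K ^+ 2.
  move=> K0 MK bK; have Ki : 0 <= K^-1 by rewrite invr_ge0 ltW.
  have := @faithful_half (K^-1%:C *: b).
  rewrite cstarZr bs rnormZr ger0_norm// => /(_ erefl) half.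
  rewrite -[leRHS]mulr1 -ler_pdivrMl ?exprn_gt0// mulrCA -exprVn -exprMn.
  apply: half; first by rewrite ler_pdivrMl// mulr1.
  move=> h; rewrite (srepZ sP) (rfZl (ipr_form H)) (rfZr (ipr_form H)) !ipr_norm.
  have : rnorm (pi b h) ^+ 2 <= M ^+ 2 * rnorm h ^+ 2.
    by rewrite -exprMn ler_pXn2r ?nnegrE ?mulr_ge0 ?rnorm_ge0// ltW.
  have -> X : 2 * (K^-1 * (K^-1 * X)) = (K ^+ 2)^-1 * (2 * X) by field; rewrite lt0r_neq0.
  rewrite ler_pdivrMl ?exprn_gt0//.
  have := sqr_ge0 (rnorm h); nra.
have b0 := rnorm_ge0 b.
have [bM2|bM2] := leP (rnorm b ^+ 2) (2 * M ^+ 2).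
  have s0 : 0 <= 2 * M ^+ 2 by rewrite mulr_ge0 ?sqr_ge0.
  have := scaled (Num.sqrt (2 * M ^+ 2)).
  rewrite sqr_sqrtr// sqrtr_gt0 mulr_gt0 ?exprn_gt0// => /(_ isT (lexx _)).
  have -> : rnorm b <= Num.sqrt (2 * M ^+ 2).
    by rewrite -(ger0_norm b0) -sqrtr_sqr ler_wsqrtr.
  by move=> /(_ isT); rewrite ler_pM2l// ler_pXn2r ?nnegrE// ltW.
have bp : 0 < rnorm b.
  rewrite lt_neqAle b0 andbT eq_sym; apply/eqP => b00.
  by move: bM2; rewrite b00 expr0n ltNge mulr_ge0 ?sqr_ge0.
by have := scaled _ bp (ltW bM2) (lexx _); have := exprn_gt0 2 bp; lra.
Qed.

(** The C*-identity reduces to [a^* a]; enlarging [M] by [e] provides the positive bound that the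
    self-adjoint case asks for. *)
Lemma faithful_norm_le (a : A) (M : R) : 0 <= M ->
  (forall h, rnorm (pi a h) <= M * rnorm h) -> rnorm a <= M.
Proof.
move=> M0 aM; apply/ler_addgt0Pr => e e0.
have Me : 0 < M + e by rewrite ltr_wpDl.
have aMe h : rnorm (pi a h) <= (M + e) * rnorm h.
  by rewrite (le_trans (aM h))// ler_wpM2r ?rnorm_ge0// lerDl ltW.
rewrite -(ler_pXn2r (n := 2))// ?nnegrE ?rnorm_ge0 ?(ltW Me)// -rnorm_cstar_cmul.
apply: faithful_selfadjoint_le; rewrite ?exprn_gt0//.
  by rewrite cstarM cstarK.
move=> h; rewrite (srepM sP) expr2 -mulrA.
have astar k : rnorm (pi (cstar a) k) <= (M + e) * rnorm k.
  apply: ipr_le_norm; first by rewrite mulr_ge0 ?rnorm_ge0// ltW.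
  move=> y; rewrite (srep_starl sP) (le_trans (ipr_le _ _))//.
  by rewrite [leRHS]mulrAC [leRHS]mulrC ler_wpM2l ?rnorm_ge0.
by rewrite (le_trans (astar _))// ler_wpM2l ?(ltW Me).
Qed.

End Isometry.

(** * Matrices over a C*-algebra *)

Definition mxact (R : realType) (H : hilbertSpace R) n (X : 'M[H -> H]_n)
    (v : 'I_n -> H) : 'I_n -> H := fun i => \sum_(j < n) X i j (v j).

Section MatrixAction.
Variables (R : realType) (H : hilbertSpace R) (n : nat).
Implicit Types (X : 'M[H -> H]_n) (v : 'I_n -> H).

Lemma mxopnorm_leP X (M : R) : (forall i j, linear (X i j)) -> 0 <= M ->
  (mxopnorm X <= M%:E)%E <-> forall v, vnorm (mxact X v) <= M * vnorm v.
Proof.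
move=> Xlin M0; split => [XM v|XM].
  have XM1 u : vnorm u <= 1 -> vnorm (mxact X u) <= M.
    move=> u1; rewrite -lee_fin; apply: le_trans XM.
    apply: ereal_sup_ubound; exists u => /=; last by rewrite -vnormE.
    by rewrite -sqr_vnorm expr_le1// vnorm_ge0.
  have [v0|v0] := eqVneq (vnorm v) 0.
    have -> : mxact X v = 0.
      apply/funext => i; rewrite /mxact big1// => j _.
      suff -> : v j = 0 by rewrite lin0.
      by apply/rnorm_eq0/eqP; rewrite eq_le rnorm_ge0 andbT -v0 rnorm_le_vnorm.
    by rewrite v0 mulr0 /vnorm /form_norm (rf0l (vform H n)) sqrtr0.
  have vp : 0 < vnorm v by rewrite lt_neqAle eq_sym v0 vnorm_ge0.
  have := XM1 ((vnorm v)^-1%:C *: v).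
  have -> : mxact X ((vnorm v)^-1%:C *: v) = (vnorm v)^-1%:C *: mxact X v.
    apply/funext => i; rewrite /mxact [RHS]scaler_sumr.
    by apply: eq_bigr => j _; rewrite linZ.
  rewrite /vnorm !(form_normZ (vform H n)) -/(vnorm v) -/(vnorm (mxact X v)).
  rewrite ger0_norm ?invr_ge0 ?vnorm_ge0// mulVf// => /(_ (lexx _)).
  by rewrite ler_pdivrMl// mulrC.
apply: ge_ereal_sup => _ [v /= v1 <-]; rewrite lee_fin -(vnormE (mxact X v)).
apply: (le_trans (XM v)); rewrite -[leRHS]mulr1 ler_wpM2l//.
by rewrite -(expr_le1 (n := 2))// ?vnorm_ge0// sqr_vnorm.
Qed.

Lemma mxopnorm_ge0 X : (0 <= mxopnorm X)%E.
Proof.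
apply: (@le_trans _ _ (vnorm (mxact X 0))%:E).
  by rewrite lee_fin vnorm_ge0.
apply: ereal_sup_ubound; exists 0 => /=; last by rewrite -vnormE.
by rewrite big1// => i _; rewrite rnorm0 expr0n.
Qed.

End MatrixAction.

Section MatrixAlgebra.
Variables (R : realType) (A : cstarAlgebra R) (n : nat).
Implicit Types x y z : 'M[A]_n.

Definition amulmx x y : 'M[A]_n := \matrix_(i, j) \sum_(k < n) cmul (x i k) (y k j).
Definition astarmx x : 'M[A]_n := \matrix_(i, j) cstar (x j i).

Lemma amulmxDl x y z : amulmx (x + y) z = amulmx x z + amulmx y z.
Proof.
apply/matrixP => i j; rewrite !mxE -big_split/=.
by apply: eq_bigr => k _; rewrite mxE cmulDl.
Qed.

Lemma amulmxDr x y z : amulmx x (y + z) = amulmx x y + amulmx x z.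
Proof.
apply/matrixP => i j; rewrite !mxE -big_split/=.
by apply: eq_bigr => k _; rewrite mxE cmulDr.
Qed.

Lemma astarmxM x y : astarmx (amulmx x y) = amulmx (astarmx y) (astarmx x).
Proof.
apply/matrixP => i j; rewrite !mxE (big_morph _ (@cstarD R A) (@cstar0 R A)).
by apply: eq_bigr => k _; rewrite !mxE cstarM.
Qed.

Lemma astarmxK x : astarmx (astarmx x) = x.
Proof. by apply/matrixP => i j; rewrite !mxE cstarK. Qed.

Section Action.
Variables (H : hilbertSpace R) (sigma : A -> H -> H).
Hypothesis sP : star_representation sigma.
Implicit Types v u : 'I_n -> H.

Definition ract x : ('I_n -> H) -> 'I_n -> H := mxact (map_mx sigma x).

Lemma ractE x v i : ract x v i = \sum_(j < n) sigma (x i j) (v j).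
Proof. by apply: eq_bigr => j _; rewrite mxE. Qed.

Lemma ractD x y v : ract (x + y) v = ract x v + ract y v.
Proof.
apply/funext => i; rewrite ractE [RHS]/GRing.add/= !ractE -big_split/=.
by apply: eq_bigr => j _; rewrite mxE srepD.
Qed.

Lemma ractZ (k : R[i]) x v : ract (map_mx ( *:%R k) x) v = k *: ract x v.
Proof.
apply/funext => i; rewrite ractE [RHS]/GRing.scale/= ractE scaler_sumr.
by apply: eq_bigr => j _; rewrite mxE srepZ.
Qed.

Lemma ractB x y v : ract (x - y) v = ract x v - ract y v.
Proof. by apply/eqP; rewrite eq_sym subr_eq -ractD subrK. Qed.

Lemma ract0 v : ract 0 v = 0.
Proof. by have := ractB 0 0 v; rewrite !subrr. Qed.

Lemma ractM x y v : ract (amulmx x y) v = ract x (ract y v).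
Proof.
apply/funext => i; rewrite !ractE.
under [RHS]eq_bigr => j _ do rewrite ractE (lin_sum (srepL sP _)).
rewrite exchange_big/=; apply: eq_bigr => j _; rewrite mxE.
elim/big_rec2: _ => [|k a b _ <-]; first by rewrite srep0.
by rewrite srepD// srepM.
Qed.

Local Notation g := (sum_form (@ipr R H) (n := n)).

Lemma ract_star x v u : g (ract (astarmx x) v) u = g v (ract x u).
Proof.
rewrite /sum_form.
under eq_bigr do rewrite ractE (rf_suml (ipr_form H)).
under [RHS]eq_bigr do rewrite ractE (rfC (ipr_form H)) (rf_suml (ipr_form H)).
rewrite exchange_big/=; apply: eq_bigr => i _; apply: eq_bigr => j _.
by rewrite mxE srep_starl// (rfC (ipr_form H)).
Qed.

(** Crude, but the constant does not depend on the representation: together with [faithful_entry_le]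
    it carries smallness from one representation to another through the entries. *)
Lemma vnorm_ract_le x v :
  vnorm (ract x v) <= (\sum_(i < n) \sum_(j < n) rnorm (x i j)) * vnorm v.
Proof.
rewrite (le_trans (vnorm_le_sum _))// mulr_suml; apply: ler_sum => i _.
rewrite ractE (le_trans (rnorm_sum _ _ _))// mulr_suml; apply: ler_sum => j _.
rewrite (le_trans (srep_contractive sP _ _))// ler_wpM2l ?rnorm_ge0//.
exact: rnorm_le_vnorm.
Qed.

End Action.

Lemma faithful_entry_le (H : hilbertSpace R) (pi : A -> H -> H) x (M : R) :
  faithful_rep pi -> 0 <= M ->
  (forall v, vnorm (ract pi x v) <= M * vnorm v) ->
  forall i j, rnorm (x i j) <= M.
Proof.
move=> piP M0 xM i j; apply: (faithful_norm_le piP M0) => h.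
pose v := fun k => if k == j then h else 0.
have -> : pi (x i j) h = ract pi x v i.
  rewrite ractE (bigD1 j)//= /v eqxx big1 ?addr0// => k /negbTE ->.
  by rewrite (lin0 (srepL piP.1 _)).
rewrite (le_trans (rnorm_le_vnorm _ _))// (le_trans (xM v))// ler_wpM2l//.
rewrite vnormE (bigD1 j)//= /v eqxx big1 => [|k /negbTE ->].
  by rewrite addr0 sqrtr_sqr ger0_norm// rnorm_ge0.
by rewrite rnorm0 expr0n.
Qed.

(* The square root of [1 - x^* x] exists in the unitization of [M_n(A)], which
   is only used through its approximations [sqrt_iter]: their increments are
   small in [M_n(pi A)], hence entrywise in [A], hence in [M_n(sigma A)]. *)
Lemma faithful_mxnorm_le (H K : hilbertSpace R) (pi : A -> H -> H)
    (sigma : A -> K -> K) x (M : R) :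
  faithful_rep pi -> star_representation sigma -> 0 <= M ->
  (forall v, vnorm (ract pi x v) <= M * vnorm v) ->
  forall v, vnorm (ract sigma x v) <= M * vnorm v.
Proof.
move=> piP sP.
(* Scaling by [M + e'] covers [M = 0], and [e'] is chosen so that [e' * vnorm v <= e]. *)
wlog -> : x M / M = 1.
  move=> wl M0 xM v; apply/ler_addgt0Pr => e e0.
  pose e' := e / (1 + vnorm v).
  have v1 : 0 < 1 + vnorm v by rewrite ltr_wpDr ?vnorm_ge0.
  have e'0 : 0 < e' by rewrite divr_gt0.
  have Mp : 0 < M + e' by rewrite ltr_wpDl.
  have vz (L : hilbertSpace R) (s : A -> L -> L) (ss : star_representation s) u :
      vnorm (ract s (map_mx ( *:%R (M + e')^-1%:C) x) u) = (M + e')^-1 * vnorm (ract s x u).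
    by rewrite (ractZ ss) /vnorm (form_normZ (vform L n)) ger0_norm// invr_ge0 ltW.
  have xM' u : vnorm (ract pi (map_mx ( *:%R (M + e')^-1%:C) x) u) <= 1 * vnorm u.
    rewrite (vz _ _ piP.1) ler_pdivrMl// mul1r (le_trans (xM u))//.
    by rewrite ler_wpM2r ?vnorm_ge0// lerDl ltW.
  have := wl _ 1 erefl ler01 xM' v; rewrite (vz _ _ sP) ler_pdivrMl// mul1r => /le_trans; apply.
  rewrite mulrDl lerD2l /e' mulrAC ler_pdivrMr//.
  by rewrite ler_wpM2l ?(ltW e0)// lerDr.
move=> _ x1 v; rewrite mul1r.
pose z := amulmx (astarmx x) x; 
pose half (y : 'M[A]_n) := map_mx ( *:%R (2^-1 : R)%:C) y.
have halfB : {morph half : a b / a - b}.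
  by move=> a b; apply/matrixP => i j; rewrite !mxE scalerBr.
pose w := sqrt_iter amulmx half z.
pose B (y : 'M[A]_n) (r : R) :=
  0 <= r /\ forall u, vnorm (ract pi y u) <= r * vnorm u.
have BD a b r s : B a r -> B b s -> B (a + b) (r + s).
  move=> [r0 ar] [s0 bs]; split=> [|u]; first exact: addr_ge0.
  rewrite (ractD piP.1) (le_trans (form_normD (vform H n) _ _))// mulrDl lerD//.
    exact: ar.
  exact: bs.
have BM a b r s : B a r -> B b s -> B (amulmx a b) (r * s).
  move=> [r0 ar] [s0 bs]; split=> [|u]; first exact: mulr_ge0.
  by rewrite (ractM piP.1) (le_trans (ar _))// -mulrA ler_wpM2l.
have BZ a r : B a r -> B (half a) (2^-1 * r).
  move=> [r0 ar]; split=> [|u]; first exact: mulr_ge0.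
  rewrite (ractZ piP.1) /vnorm (form_normZ (vform H n)) ger0_norm// -mulrA.
  by rewrite ler_pM2l//; exact: ar.
have B0 : B 0 0.
  split=> // u; rewrite (ract0 piP.1) mul0r.
  by rewrite /vnorm /form_norm (rf0l (vform H n)) sqrtr0.
have xs1 u : vnorm (ract pi (astarmx x) u) <= vnorm u.
  apply: (form_norm_le (vform H n)); first exact: vnorm_ge0.
  move=> y; rewrite (ract_star piP.1) (le_trans (rf_cauchy_schwarz (vform H n) _ _))//.
  by rewrite ler_wpM2l ?form_norm_ge0//; have := x1 y; rewrite mul1r.
have Bz : B z 1.
  split=> // u; rewrite mul1r (ractM piP.1) (le_trans (xs1 _))//.
  by have := x1 u; rewrite mul1r.
have ws k : astarmx (w k) = w k.
  elim: k => [|k IH]; first by apply/matrixP => i j; rewrite !mxE cstar0.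
  have halfs a b : astarmx (half (a + b)) = half (astarmx a + astarmx b).
    by apply/matrixP => i j; rewrite !mxE cstarZr cstarD.
  rewrite [w k.+1]/(half (z + amulmx (w k) (w k))) halfs astarmxM IH.
  by rewrite {1}/z astarmxM astarmxK.
(* The iterates are controlled in [pi] only. Passing through the n^2 entries costs a constant
   factor, so the increments still tend to 0 in [sigma]. *)
have small k : vnorm (ract sigma (w k.+1 - w k) v) <=
    n%:R ^+ 2 * vnorm v * rate R k.
  have [_ dk] := sqrt_iter_diff halfB amulmxDl amulmxDr B0 BD BM BZ Bz (leqnSn k).
  have dk' u : vnorm (ract pi (w k.+1 - w k) u) <= rate R k * vnorm u.
    apply: (le_trans (dk u)); rewrite ler_wpM2r ?vnorm_ge0//.
    have [_ t1 _] := sqrt_iter1_bounds R k.+1; have [_ _ t2] := sqrt_iter1_bounds R k.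
    by lra.
  have r0 : 0 <= rate R k by rewrite divr_ge0.
  have ent := faithful_entry_le piP r0 dk'.
  apply: (le_trans (vnorm_ract_le sP _ _)); rewrite mulrAC ler_wpM2r ?vnorm_ge0//.
  apply: (@le_trans _ _ (\sum_(i < n) \sum_(j < n) rate R k)).
    by apply: ler_sum => i _; apply: ler_sum => j _; exact: ent.
  by rewrite !sumr_const !card_ord -mulrnA -[leLHS]mulr_natl natrM expr2.
rewrite -(ler_pXn2r (n := 2))// ?nnegrE ?vnorm_ge0//.
pose N := @vnorm R K n.
rewrite -subr_le0.
apply: (@le_rate0 R _ (2 * (n%:R ^+ 2 * vnorm v) * vnorm v)) => k.
pose g := sum_form (@ipr R K) (n := n).
have gP : real_form g := vform K n.
have vg u : vnorm u ^+ 2 = g u u := sqr_form_norm gP u.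
(* The equation [z = 2 w - w^2] of the square root, up to twice an increment. *)
have zE : z = (w k.+1 - w k) + (w k.+1 - w k) + (w k + w k - amulmx (w k) (w k)).
  have wS : w k.+1 + w k.+1 = z + amulmx (w k) (w k).
    apply/matrixP => i j; rewrite ![in LHS]mxE -scalerDl -rmorphD/=.
    by rewrite (_ : 2^-1 + 2^-1 = 1 :> R) ?scale1r ?mxE//; field.
  by rewrite [X in _ = X + _]addrACA -opprD wS subrKA addrK.
have gz : g (ract sigma x v) (ract sigma x v) = g (ract sigma z v) v.
  by rewrite /z (ractM sP) /g (ract_star sP).
have gw : g (ract sigma (amulmx (w k) (w k)) v) v =
          g (ract sigma (w k) v) (ract sigma (w k) v).
  by rewrite (ractM sP) -{1}(ws k) /g (ract_star sP).
pose d := g (ract sigma (w k.+1 - w k) v) v.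
have zd : g (ract sigma z v) v = 2 * d + 2 * g (ract sigma (w k) v) v -
    g (ract sigma (w k) v) (ract sigma (w k) v).
  rewrite zE (ractD sP) (ractD sP (w k.+1 - w k)) (ractB sP (w k + w k)) (ractD sP (w k)).
  by rewrite !(rfDl gP) (rfNl gP) gw -/d; ring.
have dle : d <= n%:R ^+ 2 * vnorm v * rate R k * vnorm v.
  by rewrite (le_trans (rf_cauchy_schwarz gP _ _))// ler_wpM2r ?vnorm_ge0 ?small.
(* Here [|x v|^2 - |v|^2 = 2 d - |v - w_k v|^2], so only the increment term [d] has to be
   estimated. *)
have := rf_ge0 gP (v - ract sigma (w k) v); rewrite !vg gz zd.
rewrite (rfDl gP) (rfNl gP) !(rfDr gP) !(rfNr gP) (rfC gP v (ract sigma (w k) v)).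
by lra.
Qed.

End MatrixAlgebra.

(** * The Haar integral *)

Section CompactSupport.
Variables (R : realType) (G : topologicalType).

Definition CcR (f : G -> R) : Prop :=
  continuous f /\ exists2 C : set G, compact C & forall t, ~ C t -> f t = 0.

Lemma CcRD f g : CcR f -> CcR g -> CcR (fun t => f t + g t).
Proof.
move=> [cf [C cC Cf]] [cg [D cD Dg]]; split.
  by move=> t; apply: cvgD; [exact: cf|exact: cg].
exists (C `|` D); first exact: compactU.
by move=> t /not_orP[Ct Dt]; rewrite Cf// Dg// addr0.
Qed.

Lemma CcRM (f g : G -> R) : continuous f -> CcR g -> CcR (fun t => f t * g t).
Proof.
move=> cf [cg [D cD Dg]]; split.
  by move=> t; apply: cvgM; [exact: cf|exact: cg].
by exists D => // t Dt; rewrite Dg// mulr0.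
Qed.

Lemma CcRZ r g : CcR g -> CcR (fun t => r * g t).
Proof. by apply: CcRM => t; exact: cvg_cst. Qed.

Lemma CcRB f g : CcR f -> CcR g -> CcR (fun t => f t - g t).
Proof.
move=> fc gc; have -> : (fun t => f t - g t) = fun t => f t + -1 * g t.
  by apply/funext => t; rewrite mulN1r.
exact/CcRD/CcRZ.
Qed.

Lemma CcR_comp (V : normedModType R[i]) (F : G -> V) (l : V -> R) : Cc F ->
  (forall x y, `|l x - l y| <= rnorm (x - y)) -> l 0 = 0 ->
  CcR (fun t => l (F t)).
Proof.
move=> [cF [C cC CF]] l1 l0; split; last by exists C => // t Ct; rewrite CF.
move=> t; apply/cvgrPdist_lt => e e0.
have := (iffLR (continuous_rnormP F) cF) t e e0.
by apply: filterS => u; apply: le_lt_trans; exact: l1.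
Qed.

Lemma Cc_rnorm (V : normedModType R[i]) (F : G -> V) :
  Cc F -> CcR (fun t => rnorm (F t)).
Proof.
move=> cF; apply: CcR_comp => //; last exact: rnorm0.
move=> x y; have := rnorm_triangle y x 0; have := rnorm_triangle x y 0.
rewrite !subr0 (rnormBC y x) => h1 h2; rewrite ler_norml; apply/andP; split; lra.
Qed.

End CompactSupport.

Definition haarI (R : realType) (G : topologicalGroupType)
    (mu : {measure set (borel G) -> \bar R}) (f : G -> R) : R :=
  Rintegral mu setT (fun t : borel G => f t).

Section HaarIntegral.
Variables (R : realType) (G : topologicalGroupType).
Variables (mu : {measure set (borel G) -> \bar R}).
Hypothesis muP : left_haar_measure mu.
Hypothesis hausG : hausdorff_space G.
Implicit Types f g : G -> R.
Local Notation I := (haarI mu).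

Lemma open_borel (U : set G) : open U -> measurable (U : set (borel G)).
Proof. by move=> oU; apply: sub_sigma_algebra. Qed.

Lemma compact_borel (C : set G) : compact C -> measurable (C : set (borel G)).
Proof.
move=> cC; rewrite -[C]setCK; apply: measurableC; apply: open_borel.
by apply: closed_openC; exact: compact_closed.
Qed.

Lemma continuous_borel f : continuous f -> measurable_fun setT (f : borel G -> R).
Proof.
move=> /continuousP cf; apply: (measurability _ (RGenOpens.measurableE R)).
move=> _ [_ [a [b ->] <-]]; rewrite setTI; apply: open_borel.
by apply: cf; exact: interval_open.
Qed.

Lemma CcR_integrable f : CcR f -> mu.-integrable setT (EFin \o (f : borel G -> R)).
Proof.
move=> [cf [C cC Cf]].
have mC := compact_borel cC.
have mf := continuous_borel cf.
have -> : EFin \o (f : borel G -> R) = (EFin \o (f : borel G -> R)) \_ C.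
  apply/funext => t; rewrite patchE; case: ifPn => // /negP tC /=.
  by rewrite Cf// => Ct; exact: tC (mem_set Ct).
apply/integrable_restrict => //; rewrite setTI.
apply: measurable_bounded_integrable => //.
- exact: haar_compact muP _ cC.
- exact: measurable_funTS.
have := compact_bounded (continuous_compact (f := f) (continuous_subspaceT cf) cC).
move=> [M [Mr MP]]; exists M; split => // r Mr' t Ct; apply: MP => //.
Qed.

#[local] Hint Resolve measurableT : core.

Lemma haarID f g : CcR f -> CcR g -> I (fun t => f t + g t) = I f + I g.
Proof. by move=> cf cg; rewrite /haarI RintegralD//; exact: CcR_integrable. Qed.

Lemma haarIB f g : CcR f -> CcR g -> I (fun t => f t - g t) = I f - I g.
Proof. by move=> cf cg; rewrite /haarI RintegralB//; exact: CcR_integrable. Qed.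

Lemma haarIZ r f : CcR f -> I (fun t => r * f t) = r * I f.
Proof. by move=> cf; rewrite /haarI RintegralZl//; exact: CcR_integrable. Qed.

Lemma haarI_le f g : CcR f -> CcR g -> (forall t, f t <= g t) -> I f <= I g.
Proof. by move=> cf cg fg; apply: le_Rintegral => //; exact: CcR_integrable. Qed.

Lemma haarI_ge0 f : (forall t, 0 <= f t) -> 0 <= I f.
Proof. by move=> f0; apply: Rintegral_ge0. Qed.

Lemma haarI0 : I (fun=> 0) = 0.
Proof. by rewrite /haarI Rintegral_cst// mul0r. Qed.

Lemma haarI_sum (J : Type) (s : seq J) (F : J -> G -> R) :
  (forall j, CcR (F j)) ->
  CcR (fun t => \sum_(j <- s) F j t) /\
  I (fun t => \sum_(j <- s) F j t) = \sum_(j <- s) I (F j).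
Proof.
move=> cF; elim: s => [|j s [c IH]].
  under eq_fun do rewrite big_nil.
  rewrite big_nil haarI0; split=> //; split; first by move=> t; exact: cvg_cst.
  by exists set0 => //; exact: compact0.
under eq_fun do rewrite big_cons.
by rewrite big_cons haarID// IH; split=> //; exact: CcRD.
Qed.

Lemma continuous_mulgl (s : G) : continuous (fun t : G => (s * t)%g).
Proof.
move=> t; apply: (@continuous_comp _ _ _ (fun t : G => (s, t)) (fun p => (p.1 * p.2)%g)).
  by apply: cvg_pair => //=; exact: cvg_cst.
exact: mulg_continuous.
Qed.

Lemma Cc_shift (V : normedModType R[i]) (xi : G -> V) s :
  Cc xi -> Cc (fun t => xi (s * t)%g).
Proof.
move=> [cx [C cC Cx]]; split.
  by move=> t; apply: (@continuous_comp _ _ _ (fun t : G => (s * t)%g) xi);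
     [exact: continuous_mulgl|exact: cx].
exists [set (s^-1 * t)%g | t in C].
  apply: continuous_compact => //; apply: continuous_subspaceT.
  exact: continuous_mulgl.
move=> t Ct; apply: Cx => Cst; apply: Ct; exists (s * t)%g => //.
by rewrite mulgA mulVg mul1g.
Qed.

(** Left invariance says that [mu] is its own image under [t |-> s^-1 t]; the rest is change of
    variables. *)
Lemma haarI_shift s f : CcR f -> CcR (fun t => f (s^-1 * t)%g) ->
  I (fun t => f (s^-1 * t)%g) = I f.
Proof.
move=> cf cfs; congr fine.
pose phi : borel G -> borel G := fun t => (s^-1 * t)%g.
have mphi : measurable_fun setT phi.
  apply: (@measurability _ _ (borel G) (borel G) setT phi (@open G) erefl).
  move=> _ [U oU <-]; rewrite setTI; apply: open_borel.
  by move/continuousP : (@continuous_mulgl s^-1%g) => /(_ _ oU).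
have := integral_pushforward (phi := phi) (mu := mu) (D := setT)
  (f := EFin \o (f : borel G -> R)) mphi.
rewrite preimage_setT => <- //.
- apply: eq_measure_integral => E mE _; have mpE : measurable (phi @^-1` E).
    by rewrite -[X in measurable X]setTI; exact: (mphi measurableT E mE).
  apply: etrans (esym (haar_left_invariant muP s^-1%g mpE)) _.
  congr (mu _); apply/seteqP; split=> [_ [t Et <-]//|t Et].
  exists (s * t)%g; last by rewrite mulgA mulVg mul1g.
  by rewrite /phi /= mulgA mulVg mul1g.
- by apply/measurable_EFinP; apply: continuous_borel; case: cf.
- exact: CcR_integrable.
Qed.

End HaarIntegral.

(** * Vector-valued integrals *)

(* A family of real-linear functionals that computes the norm replaces the
   Hahn-Banach theorem in the construction of vector-valued integrals. *)
Record norming (R : realType) (V : normedModType R[i]) (L : set (V -> R)) : Prop :=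
 Norming {
  normingD : forall l x y, L l -> l (x + y) = l x + l y ;
  normingZ : forall l (r : R) x, L l -> l (r%:C *: x) = r * l x ;
  norming_le : forall l x, L l -> l x <= rnorm x ;
  norming_norm : forall x (M : R), 0 <= M -> (forall l, L l -> l x <= M) ->
    rnorm x <= M }.

Section NormingLemmas.
Variables (R : realType) (V : normedModType R[i]) (L : set (V -> R)).
Hypothesis LP : norming L.
Variables (l : V -> R).
Hypothesis Ll : L l.

Lemma norming0 : l 0 = 0.
Proof. by have := normingZ LP 0 0 Ll; rewrite scaler0 mul0r. Qed.
Lemma normingN x : l (- x) = - l x.
Proof. by apply/eqP; rewrite -addr_eq0 -(normingD LP)// addNr norming0. Qed.
Lemma normingB x y : l (x - y) = l x - l y.
Proof. by rewrite (normingD LP)// normingN. Qed.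
Lemma norming_abs x : `|l x| <= rnorm x.
Proof.
rewrite ler_norml (norming_le LP)// andbT lerNl -normingN.
by rewrite (le_trans (norming_le LP _ Ll))// rnormN.
Qed.
Lemma norming_lip x y : `|l x - l y| <= rnorm (x - y).
Proof. by rewrite -normingB norming_abs. Qed.

End NormingLemmas.

Section Bochner.
Variables (R : realType) (G : topologicalGroupType).
Variables (mu : {measure set (borel G) -> \bar R}).
Hypothesis muP : left_haar_measure mu.
Hypothesis hausG : hausdorff_space G.
Variables (V : completeNormedModType R[i]) (L : set (V -> R)).
Hypothesis LP : norming L.
Local Notation I := (haarI mu).

Lemma norming_CcR F l : Cc F -> L l -> CcR (fun t : G => l (F t)).
Proof.
move=> cF Ll; apply: CcR_comp => //; first exact: norming_lip LP _ Ll.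
exact: (norming0 LP).
Qed.

(** The set [E] varies so that the induction can split off the part of [E] in one patch [U t], where
    [F] is replaced by [F t]. One [v] serves all functionals in [L]. *)
Let riemann_sum (F : G -> V) (K : set G) (e : R) (s : seq G)
    (U : G -> set G) (E : set (borel G)) :
  Cc F -> compact K -> 0 < e -> (forall t, open (U t)) ->
  (forall t u, U t u -> rnorm (F t - F u) < e) -> measurable E -> E `<=` K ->
  (forall u, E u -> exists2 t, t \in s & U t u) ->
  exists v, forall l, L l ->
    `|Rintegral mu E (fun t : borel G => l (F t)) - l v| <= e * fine (mu E).
Proof.
move=> cF cK e0 oU UF; elim: s E => [|t s IH] E mE EK Es.
  exists 0 => l Ll; have -> : E = set0.
    by rewrite -subset0 => u /Es[].
  by rewrite Rintegral_set0 (norming0 LP)// subrr normr0 measure0 mulr0.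
pose E1 := E `&` (U t : set (borel G)); pose E2 := E `\` (U t : set (borel G)).
have mU := open_borel (oU t).
have mE1 : measurable E1 by exact: measurableI.
have mE2 : measurable E2 by exact: measurableD.
have [||v vE2] := IH E2 mE2; first by move=> u [/EK].
  move=> u [/Es[w]]; rewrite inE => /orP[/eqP -> //|ws Uwu _]; exists w => //.
have Kfin : (mu K < +oo)%E by exact: haar_compact muP _ cK.
have fin (D : set (borel G)) : measurable D -> D `<=` K -> (mu D < +oo)%E.
  move=> mD DK; apply: le_lt_trans Kfin; apply: le_measure => //; apply: mem_set => //.
  exact: (compact_borel hausG cK).
have E1K : E1 `<=` K by move=> u [/EK].
have E2K : E2 `<=` K by move=> u [/EK].
exists ((fine (mu E1))%:C *: F t + v) => l Ll.
have EE : E = E1 `|` E2.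
  by rewrite /E1 /E2 setUIDK.
have cl := norming_CcR cF Ll.
have il (D : set (borel G)) : measurable D -> mu.-integrable D (EFin \o (fun t : borel G => l (F t))).
  move=> mD; apply: (integrableS measurableT) => //; exact: CcR_integrable.
rewrite {1}EE Rintegral_setU//; last 2 first.
- by rewrite -EE; exact: il.
- by apply/eqP; rewrite /E1 /E2; apply/seteqP; split=> // u [[_ Uu] [_]].
rewrite (normingD LP)// (normingZ LP)//.
have -> : fine (mu E) = fine (mu E1) + fine (mu E2).
  rewrite {1}EE measureU//; last first.
    by rewrite /E1 /E2; apply/seteqP; split=> // u [[_ Uu] [_]].
  by rewrite fineD// ge0_fin_numE// fin.
have ifin : mu.-integrable E1 (EFin \o (fun=> l (F t))).
  apply: measurable_bounded_integrable => //; first exact: fin.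
  exact: bounded_cst.
have h1 : `|Rintegral mu E1 (fun t : borel G => l (F t)) - fine (mu E1) * l (F t)|
    <= e * fine (mu E1).
  have -> : fine (mu E1) * l (F t) = Rintegral mu E1 (fun=> l (F t)).
    by rewrite Rintegral_cst// mulrC.
  rewrite -RintegralB//; last exact: il.
  have iB : mu.-integrable E1 (EFin \o (fun u : borel G => l (F u) - l (F t))).
    have := integrableB mE1 (il _ mE1) ifin.
    by apply: eq_integrable => // u _ /=; rewrite EFinB.
  apply: (le_trans (le_normr_Rintegral mE1 iB)).
  rewrite -Rintegral_cst//; apply: le_Rintegral => //.
  - exact: integrable_norm iB.
  - apply: measurable_bounded_integrable => //; first exact: fin.
    exact: bounded_cst.
  move=> u [_ /UF Utu]; rewrite (le_trans (norming_lip LP Ll _ _))//.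
  by rewrite rnormBC ltW.
have := vE2 l Ll.
rewrite mulrDr opprD addrACA => h2; rewrite (le_trans (ler_normD _ _))// lerD//.
Qed.

(** The error of the Riemann sums is uniform over [L], so the norming property makes them a Cauchy
    sequence in [V]. *)
Lemma bochner_integral (F : G -> V) : Cc F ->
  exists v, forall l, L l -> l v = I (fun t => l (F t)).
Proof.
move=> cF; have [cF' [K cK KF]] := cF.
have mK := compact_borel hausG cK.
have Kfin : (mu K < +oo)%E by exact: haar_compact muP _ cK.
have IK l : L l -> I (fun t => l (F t)) = Rintegral mu K (fun t : borel G => l (F t)).
  move=> Ll; rewrite [RHS]Rintegral_mkcond; apply: eq_Rintegral => t _.
  rewrite patchE; case: ifPn => // /negP tK; rewrite KF ?(norming0 LP)// => Kt.
  exact: tK (mem_set Kt).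
pose m := fine (mu K); have m0 : 0 <= m by rewrite fine_ge0.
have step k : exists v, forall l, L l ->
    `|I (fun t => l (F t)) - l v| <= rate R k * m.
  have r0 : 0 < rate R k by rewrite divr_gt0// ltr0n.
  pose U t := [set u | rnorm (F t - F u) < rate R k]^°.
  have cU : K `<=` cover setT U.
    by move=> t Kt; exists t => //; exact: (iffLR (continuous_rnormP F) cF').
  have oU t : open (U t) by exact: open_interior.
  move: (cK); rewrite compact_cover => /(_ _ _ _ (fun t _ => oU t) cU)[D _ KD].
  have [||v vP] := @riemann_sum F K (rate R k) D U K cF cK r0 oU _ mK (@subset_refl _ _).
  - by move=> t u Utu; have := interior_subset Utu.
  - by move=> u /KD[t tD Utu]; exists t.
  by exists v => l Ll; rewrite IK// vP.
have [v vP] := choice step.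
have vd n k : (n <= k)%N -> rnorm (v k - v n) <= 2 * m * rate R n.
  move=> nk; have r0 j : 0 <= rate R j by rewrite divr_ge0.
  apply: (norming_norm LP); first by rewrite !mulr_ge0.
  move=> l Ll; rewrite (normingB LP)//.
  have := vP k l Ll; have := vP n l Ll; rewrite !ler_norml => /andP[a1 a2] /andP[a3 a4].
  have rr : rate R k <= rate R n.
    by rewrite ler_wpM2l// lef_pV2 ?posrE ?ltr0n// ler_nat; lia.
  have : rate R k * m <= rate R n * m by rewrite ler_wpM2r.
  lra.
have [|w vw] := rnorm_complete vd.
  by rewrite -(mulr0 (2 * m)); apply: cvgM; [exact: cvg_cst|exact: rate_cvg0].
exists w => l Ll; apply/eqP; rewrite -subr_eq0 -normr_le0.
apply: (@le_rate0 R _ (3 * m)) => n.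
have := norming_lip LP Ll (v n) w; have := vP n l Ll; have := vw n.
rewrite distrC.
have := ler_normD (l w - l (v n)) (l (v n) - I (fun t => l (F t))).
rewrite subrKA (distrC (l w) (l (v n))); lra.
Qed.

End Bochner.

(** * Continuity of translations and bump functions *)

Section CcScaling.
Variables (R : realType) (G : topologicalType) (V : normedModType R[i]).

Lemma CcZ (f : G -> R[i]^o) (F : G -> V) :
  Cc f -> continuous F -> Cc (fun t => (f t : R[i]) *: F t).
Proof.
move=> [cf [C cC Cf]] cF; split.
  by move=> t; apply: cvgZ; [exact: cf|exact: cF].
by exists C => // t Ct; rewrite Cf// scale0r.
Qed.

Lemma CcR_Cc (f : G -> R) : CcR f -> Cc (fun t => (f t)%:C : R[i]^o).
Proof.
move=> [cf [C cC Cf]]; split; last by exists C => // t Ct; rewrite Cf.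
apply/continuous_rnormP => t e e0.
have /cvgrPdist_lt/(_ _ e0) := cf t; apply: filterS => u.
by rewrite -rmorphB /rnorm normc_def/= expr0n addr0 sqrtr_sqr.
Qed.

Lemma CcRZv (f : G -> R) (v : V) : CcR f -> Cc (fun t => (f t)%:C *: v).
Proof. by move=> /CcR_Cc/CcZ; apply => t; exact: cvg_cst. Qed.

Lemma CcD (f g : G -> V) : Cc f -> Cc g -> Cc (f + g).
Proof.
move=> [cf [C cC Cf]] [cg [D cD Dg]]; split.
  by move=> t; apply: cvgD; [exact: cf|exact: cg].
exists (C `|` D); first exact: compactU.
by move=> t /not_orP[Ct Dt]; rewrite /GRing.add/= Cf// Dg// addr0.
Qed.

Lemma CcZc (k : R[i]) (g : G -> V) : Cc g -> Cc (k *: g).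
Proof.
move=> [cg [D cD Dg]]; split.
  by move=> t; apply: cvgZ; [exact: cvg_cst|exact: cg].
by exists D => // t Dt; rewrite /GRing.scale/= Dg// scaler0.
Qed.

End CcScaling.

Section Group.
Variables (R : realType) (G : topologicalGroupType).

Lemma uniform_shift (V : normedModType R[i]) (xi : G -> V) (e : R) :
  Cc xi -> 0 < e ->
  \forall s \near (1%g : G), forall t, rnorm (xi (s^-1 * t)%g - xi t) < e.
Proof.
move=> [cx [C cC Cx]] e0.
(* Both directions of the shift are controlled on [C]: if [t] is outside [C] but [s^-1 t] is inside,
   the estimate is used at [s^-1 t] with the shift by [s]. *)
have W : \forall s \near (1%g : G), C `<=`
    [set t | rnorm (xi (s^-1 * t)%g - xi t) < e /\ rnorm (xi (s * t)%g - xi t) < e].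
  have /compact_near_coveringP := cC; apply => t Ct.
  have e2 : 0 < e / 2 by rewrite divr_gt0.
  have xt := (iffLR (continuous_rnormP xi) cx) t (e / 2) e2.
  have main (h : G -> G) : continuous h -> h 1%g = 1%g ->
      \forall u \near t & s \near (1%g : G), rnorm (xi (h s * u)%g - xi u) < e.
    move=> ch h1.
    have c2 : continuous (fun p : G * G => xi (h p.2 * p.1)%g).
      move=> p; apply: (@continuous_comp _ _ _ (fun p : G * G => (h p.2 * p.1)%g) xi);
        last exact: cx.
      apply: (@continuous_comp _ _ _ (fun p : G * G => (h p.2, p.1))
        (fun p => (p.1 * p.2)%g)); last exact: mulg_continuous.
      apply: cvg_pair => /=; last exact: cvg_fst.
      by apply: (@continuous_comp _ _ _ snd h); [exact: cvg_snd|exact: ch].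
    have c1 : continuous (fun p : G * G => xi p.1).
      by move=> p; apply: (@continuous_comp _ _ _ fst xi); [exact: cvg_fst|exact: cx].
    have n2 := (iffLR (continuous_rnormP _) c2) (t, 1%g) (e / 2) e2.
    have n1 := (iffLR (continuous_rnormP _) c1) (t, 1%g) (e / 2) e2.
    rewrite /= h1 mul1g in n2.
    apply: filterS2 n1 n2 => -[u s] /= n1 n2.
    rewrite (le_lt_trans (rnorm_triangle (xi t) _ _))//.
    by rewrite rnormBC [ltRHS]splitr ltrD.
  have := main id (fun _ => cvg_id) erefl.
  have := main (fun s => s^-1%g) (@invg_continuous G) (invg1 _).
  by apply: filterS2 => -[u s] /=.
apply: filterS W => s Ws t.
have [Ct|Ct] := pselect (C t); first by have [] := Ws t Ct.
have [Cst|Cst] := pselect (C (s^-1 * t)%g).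
  have [_] := Ws _ Cst; rewrite mulgA mulgV mul1g => ?.
  by rewrite rnormBC.
by rewrite !Cx// subr0 rnorm0.
Qed.

Hypothesis hausG : hausdorff_space G.
Variables (mu : {measure set (borel G) -> \bar R}).
Hypothesis muP : left_haar_measure mu.
Local Notation I := (haarI mu).

(** If [U] were null, so would be its translates; finitely many of them cover any compact set, and
    inner regularity would make the whole group null. *)
Lemma haar_open_neq0 (U : set G) : open U -> U 1%g -> mu U <> 0%E.
Proof.
move=> oU U1 muU0; apply: (haar_neq0 muP).
rewrite (haar_inner_regular muP openT); apply/eqP; rewrite eq_le; apply/andP; split;
  last first.
  apply: ereal_sup_ubound; exists set0; last exact: measure0.
  by split=> //; exact: compact0.
apply: ge_ereal_sup => _ [C [cC _] <-].
pose W (t : G) := [set (t * u)%g | u in U].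
have WE t : W t = (fun u => (t^-1 * u)%g) @^-1` U.
  apply/seteqP; split=> [_ [u Uu <-]/=|u /= Uu].
    by rewrite mulgA mulVg mul1g.
  by exists (t^-1 * u)%g => //; rewrite mulgA mulgV mul1g.
have oW t : open (W t).
  by rewrite WE; move/continuousP : (@continuous_mulgl G t^-1%g); apply.
have W0 t : mu (W t) = 0%E by rewrite (haar_left_invariant muP)//; exact: open_borel.
have cW : C `<=` cover setT W.
  by move=> t Ct; exists t => //; exists 1%g => //; rewrite mulg1.
move: (cC); rewrite compact_cover => /(_ _ _ _ (fun t _ => oW t) cW)[D _ CD].
have mC := compact_borel hausG cC.
suff main (s : seq G) (E : set (borel G)) : measurable E ->
    (forall u, E u -> exists2 t, t \in s & W t u) -> (mu E <= 0)%E.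
  by apply: (main D) => // u /CD[t tD Wtu]; exists t.
elim: s E => [|t s IH] E mE Es.
  have -> : E = set0 by rewrite -subset0 => u /Es[].
  by rewrite measure0.
have mW := open_borel (oW t).
rewrite -(setUIDK E (W t : set (borel G))).
apply: le_trans; first by apply: measureU2; [exact: measurableI|exact: measurableD].
rewrite -[leRHS]adde0; apply: leeD.
  rewrite -(W0 t); apply: le_measure; rewrite ?mem_set//.
  exact: measurableI.
apply: IH; first exact: measurableD.
move=> u [/Es[w]]; rewrite inE => /orP[/eqP -> //|ws Wwu _]; by exists w.
Qed.

(** [f] exceeds [f(1) / 2] on an open neighbourhood of 1, which has positive measure. *)
Lemma haarI_gt0 (f : G -> R) : CcR f -> (forall t, 0 <= f t) -> 0 < f 1%g -> 0 < I f.
Proof.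
move=> cf f0 f1; rewrite lt_neqAle haarI_ge0// andbT eq_sym; apply/eqP => If0.
pose c := f 1%g / 2; have c0 : 0 < c by rewrite divr_gt0.
pose U := [set t | c < f t].
have oU : open U.
  rewrite (_ : U = f @^-1` `]c, +oo[%classic).
    by case: cf => /continuousP + _; apply; exact: interval_open.
  by apply/seteqP; split=> t /=; rewrite in_itv/= andbT.
have mU := open_borel oU.
apply: (haar_open_neq0 oU); first by rewrite /U/= /c; lra.
have mf : measurable_fun setT (f : borel G -> R) by apply: continuous_borel; case: cf.
have int := CcR_integrable muP hausG cf.
have : (c%:E * mu U <= 0)%E.
  have -> : (c%:E * mu U = \int[mu]_(t in (U : set (borel G))) cst c%:E t)%E.
    by rewrite integral_cst.
  have I0 : (\int[mu]_(t in setT) (f (t : borel G))%:E = 0)%E.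
    by rewrite -[LHS]fineK ?[fine _]If0//; exact: integrable_fin_num int.
  rewrite -I0; apply: (@le_trans _ _ (\int[mu]_(t in (U : set (borel G))) (f t)%:E)%E).
    apply: ge0_le_integral => //.
    - by move=> t _; rewrite lee_fin ltW.
    - by apply/measurable_EFinP; exact: measurable_funTS.
    - by move=> t /ltW; rewrite lee_fin.
  apply: ge0_subset_integral => //.
    exact/measurable_EFinP.
  by move=> t _; rewrite lee_fin.
rewrite pmule_rle0 ?lte_fin// => mU0.
by apply/eqP; rewrite eq_le mU0 measure_ge0.
Qed.

Hypothesis lcG : locally_compact [set: G].

Lemma bump_function (O : set G) : nbhs (1%g : G) O ->
  exists f : G -> R, [/\ CcR f, forall t, 0 <= f t, 0 < f 1%g &
    forall t, f t != 0 -> O t].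
Proof.
move=> O1.
have [U U1 [cU clU]] : exists2 U, nbhs (1%g : G) U & compact U /\ closed U.
  have [U U1 [cU clU]] := lcG (x := 1%g) Logic.I; exists U => //.
  by apply: (filterS _ (U1 : nbhs (1%g : G) (fun t => setT t -> U t))) => t; apply.
(* Complete regularity yields [f] with [f = 0] at 1 and [f = 1] on [B]; the bump is [1 - f], whose
   support condition comes from the compact [U]. *)
pose B := ~` (O `&` U)^°.
have clB : closed B by apply: open_closedC; exact: open_interior.
have B1 : ~ B 1%g by apply; rewrite /interior/=; exact: filterI.
have := locally_compact_completely_regular (R := R) lcG hausG clB B1.
move=> /(uniform_separatorP (R := R))[f [cf f01 fa fb]].
have fB t : B t -> f t = 1 by move=> Bt; apply: fb; exists t.
have OU t : 1 - f t != 0 -> (O `&` U) t.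
  move=> ft; apply: interior_subset; apply: contrapT => Bt.
  by move: ft; rewrite fB ?subrr ?eqxx.
exists (fun t => 1 - f t); split.
- split; first by move=> t; apply: cvgB; [exact: cvg_cst|exact: cf].
  exists U => // t Ut; apply/eqP; apply: contrapT => /negP/OU[].
  by [].
- move=> t; have := f01 (f t); rewrite /= in_itv/= => /(_ _)/andP[]; last first.
    by rewrite subr_ge0.
  by exists t.
- have -> : f 1%g = 0 by apply: fa; exists 1%g.
  by rewrite subr0.
- by move=> t /OU[].
Qed.

End Group.

(** * Operators on L2(G, H) *)

Lemma rnorm_le_rate0 (R : realType) (V : normedModType R[i]) (x : V) (C : R) :
  (forall n, rnorm x <= C * rate R n) -> x = 0.
Proof.
move=> xC; apply/rnorm_eq0/eqP; rewrite eq_le rnorm_ge0 andbT.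
exact: le_rate0 xC.
Qed.

Lemma rate_gt0 (R : realType) n : 0 < rate R n.
Proof. by rewrite divr_gt0// ltr0n. Qed.

Section HilbertNorming.
Variables (R : realType) (H : hilbertSpace R).

Lemma hilbert_norming :
  norming [set l : H -> R | exists2 y, rnorm y <= 1 & l = (fun x => ipr x y)].
Proof.
split=> [_ x y [z _ ->]|_ r x [z _ ->]|_ x [z z1 ->]|x M M0 xM].
- exact: rfDl (ipr_form H) _ _ _.
- exact: rfZl (ipr_form H) _ _ _.
- rewrite (le_trans (ipr_le _ _))// -[leRHS]mulr1 ler_wpM2l ?rnorm_ge0//.
- apply: ipr_le_norm => // y.
  have [y0|y0] := eqVneq (rnorm y) 0.
    by rewrite y0 mulr0 (rnorm_eq0 y0) (rfC (ipr_form H)) (rf0l (ipr_form H)).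
  have yp : 0 < rnorm y by rewrite lt_neqAle eq_sym y0 rnorm_ge0.
  have := xM (fun x => ipr x ((rnorm y)^-1%:C *: y)).
  rewrite (rfZr (ipr_form H)) ler_pdivrMl// mulrC; apply.
  exists ((rnorm y)^-1%:C *: y) => //.
  by rewrite rnormZr ger0_norm ?invr_ge0 ?rnorm_ge0// mulVf.
Qed.

Variables (G : topologicalGroupType) (mu : {measure set (borel G) -> \bar R}).
Hypothesis muP : left_haar_measure mu.
Hypothesis hausG : hausdorff_space G.

Lemma Cc_ipr (xi eta : G -> H) : Cc xi -> Cc eta -> CcR (fun t => ipr (xi t) (eta t)).
Proof.
move=> cx ce.
(* Polarization reduces continuity of the pairing to that of norms. *)
have -> : (fun t => ipr (xi t) (eta t)) =
    fun t => 4^-1 * (rnorm ((xi + eta) t) * rnorm ((xi + eta) t) -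
                     rnorm ((xi - eta) t) * rnorm ((xi - eta) t)).
  apply/funext => t; rewrite -!expr2 -!ipr_norm.
  rewrite (_ : (xi + eta) t = xi t + eta t)// (_ : (xi - eta) t = xi t - eta t)// iprBl.
  rewrite !(rfDl (ipr_form H)) !(rfDr (ipr_form H)) !(rfNr (ipr_form H)).
  by rewrite (rfC (ipr_form H) (eta t) (xi t)); field.
have cN : Cc (xi - eta) by rewrite -scaleN1r; apply: CcD => //; exact: CcZc.
apply: CcRZ; apply: CcRB.
  have c := Cc_rnorm (CcD cx ce); apply: (CcRM _ c); exact: c.1.
have c := Cc_rnorm cN; apply: (CcRM _ c); exact: c.1.
Qed.

Lemma Cc_iprl (F : G -> H) y : Cc F -> CcR (fun t => ipr (F t) y).
Proof.
move=> cF; have -> : (fun t => ipr (F t) y) =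
    fun t => (1 + rnorm y) * ipr (F t) ((1 + rnorm y)^-1%:C *: y).
  apply/funext => t; rewrite (rfZr (ipr_form H)) mulrA mulfV ?mul1r//.
  by rewrite gt_eqF// ltr_wpDr ?rnorm_ge0.
have y1 : 0 < 1 + rnorm y by rewrite ltr_wpDr ?rnorm_ge0.
apply: CcRZ; apply: (@norming_CcR _ _ _ _ hilbert_norming F (fun x => ipr x ((1 + rnorm y)^-1%:C *: y)) cF).
exists ((1 + rnorm y)^-1%:C *: y) => //.
rewrite rnormZr ger0_norm ?invr_ge0 ?(ltW y1)// ler_pdivrMl// mulr1.
by rewrite lerDr.
Qed.

Lemma hilbert_bochner (F : G -> H) : Cc F ->
  exists v, forall y, ipr v y = haarI mu (fun t => ipr (F t) y).
Proof.
move=> cF; have [v vP] := bochner_integral muP hausG hilbert_norming cF.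
exists v => y.
have y1 : 0 < 1 + rnorm y by rewrite ltr_wpDr ?rnorm_ge0.
pose y' := (1 + rnorm y)^-1%:C *: y.
have : ipr v y' = haarI mu (fun t => ipr (F t) y').
  apply: (vP (fun x => ipr x y')); exists y' => //.
  rewrite rnormZr ger0_norm ?invr_ge0 ?(ltW y1)// ler_pdivrMl// mulr1.
  by rewrite lerDr.
under [in RHS]eq_fun do rewrite (rfZr (ipr_form H)).
rewrite (rfZr (ipr_form H)) (haarIZ muP hausG); last exact: Cc_iprl.
by apply: mulfI; rewrite invr_eq0 gt_eqF.
Qed.

End HilbertNorming.

Section L2Operators.
Variables (R : realType) (G : topologicalGroupType).
Variables (mu : {measure set (borel G) -> \bar R}).
Variables (H : hilbertSpace R) (L2 : L2space mu H).
Hypothesis muP : left_haar_measure mu.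
Hypothesis hausG : hausdorff_space G.
Implicit Types xi eta : G -> H.
Local Notation cl := (L2_class L2).
Local Notation I := (haarI mu).

Lemma cl_lin (k : R[i]) xi eta : Cc xi -> Cc eta ->
  cl (k *: xi + eta) = k *: cl xi + cl eta.
Proof. exact: L2_class_linear. Qed.

Lemma clB xi eta : Cc xi -> Cc eta -> cl (xi - eta) = cl xi - cl eta.
Proof. by move=> cx ce; rewrite addrC -scaleN1r cl_lin// scaleN1r addrC. Qed.

Lemma ipr_cl xi eta : Cc xi -> Cc eta ->
  ipr (cl xi) (cl eta) = I (fun t => ipr (xi t) (eta t)).
Proof. by move=> cx ce; rewrite /ipr L2_class_ip. Qed.

Lemma rnorm_cl xi : Cc xi -> rnorm (cl xi) ^+ 2 = I (fun t => rnorm (xi t) ^+ 2).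
Proof.
move=> cx; rewrite -ipr_norm ipr_cl//.
by congr haarI; apply/funext => t; rewrite ipr_norm.
Qed.

Lemma Cc_sqr_rnorm xi : Cc xi -> CcR (fun t => rnorm (xi t) ^+ 2).
Proof. by move=> cx; have c := Cc_rnorm cx; apply: (CcRM _ c); exact: c.1. Qed.

Lemma rnorm_cl_le xi eta (M : R) : Cc xi -> Cc eta -> 0 <= M ->
  (forall t, rnorm (xi t) <= M * rnorm (eta t)) -> rnorm (cl xi) <= M * rnorm (cl eta).
Proof.
move=> cx ce M0 le; rewrite -(ler_pXn2r (n := 2))// ?nnegrE ?mulr_ge0 ?rnorm_ge0//.
rewrite exprMn !rnorm_cl// -(haarIZ muP hausG); last exact: Cc_sqr_rnorm.
apply: (haarI_le muP hausG); [exact: Cc_sqr_rnorm|exact/CcRZ/Cc_sqr_rnorm|].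
by move=> t; rewrite -exprMn ler_pXn2r ?nnegrE ?mulr_ge0 ?rnorm_ge0.
Qed.

Lemma cl_approx (x : L2) : exists xi : nat -> G -> H,
  forall n, Cc (xi n) /\ rnorm (x - cl (xi n)) <= rate R n.
Proof.
have ex n : exists xi : G -> H, Cc xi /\ rnorm (x - cl xi) <= rate R n.
  by have [xi cx /ltW] := L2_class_dense x (rate_gt0 R n); exists xi.
by have [f fP] := choice ex; exists f.
Qed.

(** Extension by density. Nothing is known about [L2_operator F] until some bounded operator acting
    by [F] has been constructed. *)
Lemma L2_extend (F : (G -> H) -> G -> H) (M : R) : 0 <= M ->
  (forall xi, Cc xi -> Cc (F xi)) ->
  (forall (k : R[i]) xi eta, Cc xi -> Cc eta ->
     F (k *: xi + eta) = k *: F xi + F eta) ->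
  (forall xi, Cc xi -> rnorm (cl (F xi)) <= M * rnorm (cl xi)) ->
  [/\ bounded_op (@L2_operator R G mu H L2 F),
      forall xi, Cc xi -> @L2_operator R G mu H L2 F (cl xi) = cl (F xi) &
      forall x, rnorm (@L2_operator R G mu H L2 F x) <= M * rnorm x].
Proof.
move=> M0 FC Flin FM.
have FB xi eta : Cc xi -> Cc eta ->
    rnorm (cl (F xi) - cl (F eta)) <= M * rnorm (cl xi - cl eta).
  move=> cx ce; rewrite -!clB//; try exact: FC.
  have -> : F xi - F eta = F (xi - eta).
    by rewrite addrC -scaleN1r -Flin// scaleN1r addrC.
  by apply: FM; rewrite addrC -scaleN1r; apply: CcD => //; exact: CcZc.
(* The value at [x] is specified by its distance to all [cl (F xi)] at once, which makes it
   independent of the approximating sequence. *)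
have ex (x : L2) : exists y : L2, forall xi, Cc xi ->
    rnorm (y - cl (F xi)) <= M * rnorm (x - cl xi).
  have [xs xsP] := cl_approx x.
  have r0 := rate_gt0 R.
  have [||y yP] := @rnorm_complete R L2 (fun n => cl (F (xs n))) (fun n => 2 * M * rate R n).
  - move=> n m nm; have [cn dn] := xsP n; have [cm dm] := xsP m.
    rewrite (le_trans (FB _ _ cm cn))//.
    have := rnorm_triangle x (cl (xs m)) (cl (xs n)); rewrite (rnormBC _ x).
    have : rate R m <= rate R n.
      by rewrite ler_wpM2l// lef_pV2 ?posrE ?ltr0n// ler_nat; lia.
    by have := r0 n; nra.
  - by rewrite -(mulr0 (2 * M)); apply: cvgM; [exact: cvg_cst|exact: rate_cvg0].
  exists y => xi cx; rewrite -subr_le0; apply: (@le_rate0 R _ (3 * M)) => n.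
  have [cn dn] := xsP n.
  have := rnorm_triangle (cl (F (xs n))) y (cl (F xi)).
  have := yP n; have := FB _ _ cn cx.
  have : M * rnorm (cl (xs n) - cl xi) <= M * (rate R n + rnorm (x - cl xi)).
    rewrite ler_wpM2l// (le_trans (rnorm_triangle x _ _))// lerD2r.
    by rewrite rnormBC.
  by rewrite (rnormBC _ y); lra.
have [P PP] := choice ex.
have PE xi : Cc xi -> P (cl xi) = cl (F xi).
  move=> cx; apply/eqP; rewrite -subr_eq0; apply/eqP/rnorm_eq0/eqP.
  by rewrite eq_le rnorm_ge0 andbT (le_trans (PP _ _ cx))// subrr rnorm0 mulr0.
(* Proved for every [Q] that meets the specification, because [get] returns an unknown one. *)
have bound (Q : L2 -> L2) : bounded_op Q ->
    (forall xi, Cc xi -> Q (cl xi) = cl (F xi)) ->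
    forall x, rnorm (Q x) <= M * rnorm x.
  move=> [Ql [K QK]] QE x; rewrite -subr_le0.
  apply: (@le_rate0 R _ (`|K| + M)) => n; have [xs /(_ n)[cn dn]] := cl_approx x.
  have := rnormD (Q (x - cl (xs n))) (Q (cl (xs n))); rewrite -linD// subrK.
  have : rnorm (Q (x - cl (xs n))) <= `|K| * rate R n.
    rewrite (le_trans (QK _))// (le_trans (ler_wpM2r _ (ler_norm K))) ?rnorm_ge0//.
    by rewrite ler_wpM2l.
  rewrite QE//; have := FM _ cn.
  have := rnormD x (cl (xs n) - x); rewrite subrKC (rnormBC _ x).
  nra.
have Plin : linear P.
  move=> k x y; apply/eqP; rewrite -subr_eq0; apply/eqP.
  pose K := complex.Re `|k|.
  have K0 : 0 <= K by rewrite /K normc_def/= sqrtr_ge0.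
  apply: (@rnorm_le_rate0 _ _ _ (2 * M * (K + 1))) => n.
  have [xs /(_ n)[cx dx]] := cl_approx x; have [ys /(_ n)[cy dy]] := cl_approx y.
  have cxy : Cc (k *: xs n + ys n) by apply: CcD => //; exact: CcZc.
  have h0 := PP (k *: x + y) _ cxy.
  rewrite Flin// !cl_lin// in h0; try exact: FC.
  have h1 : rnorm (k *: x + y - (k *: cl (xs n) + cl (ys n))) <= (K + 1) * rate R n.
    rewrite opprD addrACA -scalerBr (le_trans (rnormD _ _))// rnormZ mulrDl mul1r.
    by rewrite lerD// ler_wpM2l.
  have h2 : rnorm (k *: cl (F (xs n)) + cl (F (ys n)) - (k *: P x + P y)) <=
      (K + 1) * (M * rate R n).
    rewrite opprD addrACA -scalerBr (le_trans (rnormD _ _))// rnormZ mulrDl mul1r.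
    rewrite !(rnormBC (cl _)) lerD//.
      by rewrite ler_wpM2l// (le_trans (PP _ _ cx))// ler_wpM2l.
    by rewrite (le_trans (PP _ _ cy))// ler_wpM2l.
  have := rnorm_triangle (k *: cl (F (xs n)) + cl (F (ys n))) (P (k *: x + y)) (k *: P x + P y).
  have : M * rnorm (k *: x + y - (k *: cl (xs n) + cl (ys n))) <= M * ((K + 1) * rate R n).
    by rewrite ler_wpM2l.
  nra.
have Pb : bounded_op P.
  split=> //; exists M => x.
  rewrite -subr_le0; apply: (@le_rate0 R _ (2 * M)) => n.
  have [xs /(_ n)[cn dn]] := cl_approx x.
  have := PP x _ cn; have := FM _ cn.
  have := rnormD (P x - cl (F (xs n))) (cl (F (xs n))); rewrite subrK.
  have := rnormD x (cl (xs n) - x); rewrite subrKC (rnormBC _ x).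
  nra.
have [Ob OE] : bounded_op (@L2_operator R G mu H L2 F) /\
    forall xi, Cc xi -> @L2_operator R G mu H L2 F (cl xi) = cl (F xi).
  by apply: (getPex (P := [set P | bounded_op P /\ forall xi, Cc xi ->
      P (cl xi) = cl (F xi)])); exists P.
by split=> //; exact: bound.
Qed.

End L2Operators.

(** * The operators generating the crossed product *)

Section CrossedProductOperators.
Variables (R : realType) (A : cstarAlgebra R) (G : topologicalGroupType).
Variables (alpha : G -> A -> A) (mu : {measure set (borel G) -> \bar R}).
Variables (H : hilbertSpace R) (pi : A -> H -> H) (L2 : L2space mu H).
Hypothesis hausG : hausdorff_space G.
Hypothesis dynP : dynamical_system alpha.
Hypothesis muP : left_haar_measure mu.
Hypothesis piP : faithful_rep pi.
Implicit Types (xi eta : G -> H) (a : A) (s t : G).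
Local Notation cl := (L2_class L2).
Local Notation I := (haarI mu).
Local Notation tpi := (@tilde_pi R A G alpha mu H pi L2).
Local Notation trans := (@translation R G mu H L2).
Local Notation intop := (@integrated_op R A G alpha mu H pi L2).

(** [tilde_pi a] acts at the point t through such a representation. Being faithful, it is among
    those over which [mxnorm] is a supremum. *)
Lemma twisted_rep t : faithful_rep (fun a => pi (alpha t a)).
Proof.
have [sP injp] := piP; split; last first.
  by move=> a b /injp/(bij_inj (dyn_bijective dynP t)).
split=> [a|k a b|a b|a x y].
- exact: srep_bounded sP _.
- by rewrite (dyn_linear dynP) (srep_linear sP).
- by rewrite (dyn_mul dynP) (srep_mul sP).
- by rewrite (dyn_star dynP) (srep_star sP).
Qed.

Lemma twisted_le t a h : rnorm (pi (alpha t a) h) <= rnorm a * rnorm h.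
Proof. exact: (srep_contractive (twisted_rep t).1). Qed.

Definition multiplier a (xi : G -> H) : G -> H := fun t => pi (alpha t^-1%g a) (xi t).

Lemma Cc_multiplier a xi : Cc xi -> Cc (multiplier a xi).
Proof.
move=> [cx [C cC Cx]]; split; last first.
  by exists C => // t Ct; rewrite /multiplier Cx// (lin0 (srepL piP.1 _)).
apply/continuous_rnormP => t e e0.
have ca : continuous (fun t => alpha t^-1%g a).
  move=> u; apply: (@continuous_comp _ _ _ (fun t : G => t^-1%g) (fun t => alpha t a)).
    exact: invg_continuous.
  exact: dyn_continuous dynP _ _.
pose d := e / (rnorm a + rnorm (xi t) + 1).
have a0 := rnorm_ge0 a; have x0 := rnorm_ge0 (xi t).
have d0 : 0 < d by rewrite divr_gt0//; lra.
have de : d * (rnorm a + rnorm (xi t) + 1) = e by rewrite /d divfK//; lra.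
have n1 := (iffLR (continuous_rnormP _) ca) t d d0.
have n2 := (iffLR (continuous_rnormP _) cx) t d d0.
apply: filterS2 n1 n2 => u n1 n2; rewrite /multiplier.
rewrite (le_lt_trans (rnorm_triangle (pi (alpha u^-1%g a) (xi t)) _ _))//.
rewrite -(linB (srepL piP.1 _)) -(srepB piP.1).
have := srep_contractive piP.1 (alpha t^-1%g a - alpha u^-1%g a) (xi t).
have := twisted_le u^-1%g a (xi t - xi u).
nra.
Qed.

Lemma multiplier_linear a (k : R[i]) xi eta :
  multiplier a (k *: xi + eta) = k *: multiplier a xi + multiplier a eta.
Proof.
apply/funext => t; rewrite /multiplier.
by rewrite (_ : (k *: xi + eta) t = k *: xi t + eta t)// (srepL piP.1).
Qed.

Lemma tilde_piP a :
  [/\ bounded_op (tpi a),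
      forall xi, Cc xi -> tpi a (cl xi) = cl (multiplier a xi) &
      forall x, rnorm (tpi a x) <= rnorm a * rnorm x].
Proof.
apply: (@L2_extend _ _ _ _ L2 (multiplier a) _ (rnorm_ge0 a)) => [xi|k xi eta _ _|xi cx].
- exact: Cc_multiplier.
- exact: multiplier_linear.
- apply: (rnorm_cl_le L2 muP hausG) => //; [exact: Cc_multiplier|exact: rnorm_ge0|].
  by move=> t; exact: twisted_le.
Qed.

Definition translate s (xi : G -> H) : G -> H := fun t => xi (s^-1 * t)%g.

Lemma Cc_translate s xi : Cc xi -> Cc (translate s xi).
Proof. exact: Cc_shift. Qed.

Lemma rnorm_cl_shift s xi : Cc xi -> rnorm (cl (translate s xi)) = rnorm (cl xi).
Proof.
move=> cx; apply/eqP; rewrite -(eqrXn2 (n := 2))// ?rnorm_ge0// !rnorm_cl//; last first.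
  exact: Cc_translate.
apply/eqP; apply: (@haarI_shift _ _ _ muP hausG s (fun t => rnorm (xi t) ^+ 2)).
  exact: Cc_sqr_rnorm.
exact: Cc_sqr_rnorm (Cc_translate s cx).
Qed.

Lemma translationP s :
  [/\ bounded_op (trans s),
      forall xi, Cc xi -> trans s (cl xi) = cl (translate s xi) &
      forall x, rnorm (trans s x) <= rnorm x].
Proof.
have [|||b e n] := @L2_extend _ _ _ _ L2 (translate s) _ ler01.
- exact: Cc_translate.
- by [].
- by move=> xi cx; rewrite rnorm_cl_shift// mul1r.
by split=> // x; have := n x; rewrite mul1r.
Qed.

(** If the shift moves [xi] by less than [d] uniformly, the squared difference is at most [d] times
    the sum of both norms, whose integral [2 m] does not depend on the shift. No common compact
    support is needed. *)
Lemma shift_near1 xi (e : R) : Cc xi -> 0 < e ->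
  \forall s \near (1%g : G), rnorm (cl (translate s xi) - cl xi) < e.
Proof.
move=> cx e0.
pose m := I (fun t => rnorm (xi t)).
have m0 : 0 <= m by apply: haarI_ge0 => t; exact: rnorm_ge0.
pose d := e ^+ 2 / (2 * m + 1).
have d0 : 0 < d by rewrite divr_gt0 ?exprn_gt0//; lra.
apply: filterS (uniform_shift cx d0) => s sd.
rewrite -(ltr_pXn2r (n := 2))// ?nnegrE ?rnorm_ge0 ?(ltW e0)//.
rewrite -clB//; last exact: Cc_translate.
have cs := Cc_translate s cx.
have cB : Cc (translate s xi - xi) by rewrite -scaleN1r; apply: CcD => //; exact: CcZc.
rewrite rnorm_cl//.
have cn := Cc_rnorm cx; have cns := Cc_rnorm cs.
apply: (@le_lt_trans _ _ (d * (m + m))).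
  have <- : I (fun t => d * (rnorm (translate s xi t) + rnorm (xi t))) = d * (m + m).
    rewrite (haarIZ muP hausG) ?(haarID muP hausG)//; last exact: CcRD.
    by congr (_ * (_ + _)); apply: (haarI_shift muP hausG).
  apply: (haarI_le muP hausG); [exact: Cc_sqr_rnorm|exact/CcRZ/CcRD|].
  move=> t; rewrite (_ : (translate s xi - xi) t = translate s xi t - xi t)// expr2.
  rewrite ler_pM ?rnorm_ge0//; first exact/ltW/sd.
  by rewrite (le_trans (rnormD _ _))// rnormN.
have de : d * (2 * m + 1) = e ^+ 2 by rewrite /d divfK//; lra.
lra.
Qed.

(** By density and [|lambda_s| <= 1] it suffices to treat C_c functions, where shifting by [s] is
    shifting by [s s0^-1] after [s0]. *)
Lemma translation_continuous (x : L2) : continuous (fun s => trans s x).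
Proof.
apply/continuous_rnormP => s0 e e0.
have e3 : 0 < e / 3 by rewrite divr_gt0.
have [xi cx xe] := L2_class_dense x e3.
have near0 := shift_near1 (Cc_translate s0 cx) e3.
have : \forall s \near s0,
    rnorm (cl (translate (s * s0^-1)%g (translate s0 xi)) - cl (translate s0 xi)) < e / 3.
  have c : (fun s : G => (s * s0^-1)%g) @ s0 --> (1%g : G).
    rewrite -(mulgV s0).
    apply: (@continuous_comp _ _ _ (fun s : G => (s, s0^-1%g)) (fun p => (p.1 * p.2)%g)).
      by apply: cvg_pair => //=; exact: cvg_cst.
    exact: mulg_continuous.
  exact: c _ near0.
apply: filterS => s.
have -> : translate (s * s0^-1)%g (translate s0 xi) = translate s xi.
  by apply/funext => t; rewrite /translate invgM invgK !mulgA mulVg mul1g.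
have [[l0 _] p0 n0] := translationP s0; have [[l1 _] p1 n1] := translationP s.
rewrite -p0// -p1// => h.
have := rnorm_triangle (trans s0 (cl xi)) (trans s0 x) (trans s x).
have := rnorm_triangle (trans s (cl xi)) (trans s0 (cl xi)) (trans s x).
have := n0 (x - cl xi); have := n1 (x - cl xi); rewrite !linB//.
rewrite (rnormBC (trans s x)) (rnormBC (trans s (cl xi)) (trans s0 (cl xi))) in h *.
lra.
Qed.

Lemma bounded_continuous (K : hilbertSpace R) (P : L2 -> K) (M : R) (F : G -> L2) :
  linear P -> (forall x, rnorm (P x) <= M * rnorm x) -> continuous F ->
  continuous (fun t => P (F t)).
Proof.
move=> Pl PM cF; apply/continuous_rnormP => t e e0.
have M1 : 0 < `|M| + 1 by rewrite ltr_wpDl.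
have d0 : 0 < e / (`|M| + 1) by rewrite divr_gt0.
apply: filterS ((iffLR (continuous_rnormP _) cF) t _ d0) => u.
rewrite ltr_pdivlMr// => h; rewrite -linB//; apply: le_lt_trans h.
rewrite (le_trans (PM _))// mulrC ler_wpM2l ?rnorm_ge0//.
by rewrite (le_trans (ler_norm M))// lerDl.
Qed.

Definition integrand (f : G -> R[i]) a (x : L2) : G -> L2 :=
  fun s => f s *: tpi a (trans s x).

Lemma Cc_integrand (f : G -> R[i]) a x :
  Cc (f : G -> R[i]^o) -> Cc (integrand f a x).
Proof.
move=> cf; apply: CcZ => //.
have [[l _] _ n] := tilde_piP a.
exact: (@bounded_continuous L2 (tpi a) _ (fun s => trans s x) l n (translation_continuous (x := x))).
Qed.

(** A candidate is built pointwise from vector-valued integrals. Only real parts are handled;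
    pairing with [i y] recovers the imaginary part of the specification. *)
Lemma integrated_opP (f : G -> R[i]) a : Cc (f : G -> R[i]^o) ->
  bounded_op (intop f a) /\
  forall x y, ipr (intop f a x) y =
    I (fun s => ipr (integrand f a x s) y).
Proof.
move=> cf.
have ex x : exists v : L2, forall y, ipr v y = I (fun s => ipr (integrand f a x s) y).
  exact/(hilbert_bochner muP hausG)/Cc_integrand.
have [X XP] := choice ex.
have [[tl _] _ tn] := tilde_piP a.
have lin_int k x y s : integrand f a (k *: x + y) s =
    k *: integrand f a x s + integrand f a y s.
  have [[ll _] _ _] := translationP s.
  by rewrite /integrand ll tl scalerDr !scalerA mulrC.
have ci x y := Cc_iprl y (Cc_integrand a x cf).
have Xl : linear X.
  move=> k x y; apply: ipr_inj => z.
  rewrite (rfDl (ipr_form _)) iprZ !XP -!(haarIZ muP hausG)//.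
  rewrite -(haarIB muP hausG); try exact: CcRZ.
  rewrite -(haarID muP hausG)//; last by apply: CcRB; exact: CcRZ.
  congr haarI; apply/funext => s.
  by rewrite lin_int (rfDl (ipr_form _)) iprZ.
have cn : CcR (fun s => rnorm (f s : R[i]^o)) := Cc_rnorm cf.
have Xb : bounded_op X.
  split=> //; exists (rnorm a * I (fun s => rnorm (f s : R[i]^o))) => x.
  apply: ipr_le_norm.
    rewrite !mulr_ge0 ?rnorm_ge0//; apply: haarI_ge0 => s; exact: rnorm_ge0.
  move=> y; rewrite XP.
  have -> : rnorm a * I (fun s => rnorm (f s : R[i]^o)) * rnorm x * rnorm y =
      I (fun s => (rnorm a * rnorm x * rnorm y) * rnorm (f s : R[i]^o)).
    by rewrite (haarIZ muP hausG)//; ring.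
  apply: (haarI_le muP hausG) => //; first exact: CcRZ.
  move=> s; rewrite (le_trans (ipr_le _ _))// rnormZ -/(rnorm (f s : R[i]^o)).
  rewrite [leRHS]mulrC mulrA ler_wpM2r ?rnorm_ge0// ler_wpM2l ?rnorm_ge0//.
  rewrite (le_trans (tn _))// ler_wpM2l ?rnorm_ge0//.
  by have [_ _] := translationP s; apply.
pose prop (Y : L2 -> L2) := bounded_op Y /\ forall x y, ip (Y x) y =
  cintegral mu (fun s => f s * ip (tpi a (trans s x)) y).
have ipZ (K : hilbertSpace R) (k : R[i]) (u v : K) : k * ip u v = ip (k *: u) v.
  have := ip_linearl k u 0 v; rewrite addr0 => ->.
  have /eqP := ip_linearl 1 (0 : K) 0 v.
  by rewrite scale1r addr0 mul1r -subr_eq subrr eq_sym => /eqP->; rewrite addr0.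
have pX : prop X.
  split=> // x y; apply/eqP; rewrite eq_complex; apply/andP; split; apply/eqP.
    rewrite -[LHS]/(ipr (X x) y) XP /=.
    by congr haarI; apply/funext => s; rewrite ipZ.
  rewrite Im_ip XP /=.
  by congr haarI; apply/funext => s; rewrite ipZ Im_ip.
have [Ob OP] : prop (intop f a).
  by apply: (getPex (P := prop)); exists X.
split=> // x y; rewrite /ipr OP /=.
by congr haarI; apply/funext => s; rewrite ipZ.
Qed.

End CrossedProductOperators.

(** * The slice map *)

Lemma unit_vector (R : realType) (H : hilbertSpace R) :
  (exists h : H, rnorm h = 1) \/ forall h : H, h = 0.
Proof.
have [[h h0]|all0] := pselect (exists h : H, rnorm h != 0); last first.
  right=> h; apply: rnorm_eq0; apply/eqP; apply: contrapT => /negP h0.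
  by apply: all0; exists h.
left; exists ((rnorm h)^-1%:C *: h).
by rewrite rnormZr ger0_norm ?invr_ge0 ?rnorm_ge0// mulVf.
Qed.

Lemma opnorm_le (R : realType) (K : hilbertSpace R) (P : K -> K) (M : R) :
  linear P -> (opnorm P <= M%:E)%E -> forall x, rnorm (P x) <= M * rnorm x.
Proof.
move=> Pl PM x; have P1 y : rnorm y <= 1 -> rnorm (P y) <= M.
  by move=> y1; rewrite -lee_fin; apply: le_trans PM; apply: ereal_sup_ubound; exists y.
have [x0|x0] := eqVneq (rnorm x) 0.
  by rewrite (rnorm_eq0 x0) lin0// rnorm0 mulr0.
have xp : 0 < rnorm x by rewrite lt_neqAle eq_sym x0 rnorm_ge0.
have := P1 ((rnorm x)^-1%:C *: x).
rewrite linZ// !rnormZr ger0_norm ?invr_ge0 ?rnorm_ge0// mulVf// => /(_ (lexx _)).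
by rewrite ler_pdivrMl// mulrC.
Qed.

Section FaithfulNorming.
Variables (R : realType) (A : cstarAlgebra R) (H : hilbertSpace R).
Variables (pi : A -> H -> H).
Hypothesis piP : faithful_rep pi.

Lemma faithful_ipr_le (a : A) (M : R) : 0 <= M ->
  (forall h k, ipr (pi a h) k <= M * rnorm h * rnorm k) -> rnorm a <= M.
Proof.
move=> M0 aM; apply: (faithful_norm_le piP M0) => h.
by apply: ipr_le_norm => //; rewrite mulr_ge0 ?rnorm_ge0.
Qed.

Lemma faithful_ipr_inj (a b : A) :
  (forall h k, ipr (pi a h) k = ipr (pi b h) k) -> a = b.
Proof. by move=> ab; apply: piP.2; apply/funext => h; apply: ipr_inj => k. Qed.

(** These functionals compute the norm because [pi] is isometric. Integrals of A-valued functions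
    thereby exist in [A], not merely in B(H). *)
Lemma faithful_norming : norming [set l : A -> R | exists h k,
  [/\ rnorm h <= 1, rnorm k <= 1 & l = (fun a => ipr (pi a h) k)]].
Proof.
split=> [_ x y [h [k [_ _ ->]]]|_ r x [h [k [_ _ ->]]]|_ x [h [k [h1 k1 ->]]]|x M M0 xM].
- by rewrite (srepD piP.1) (rfDl (ipr_form H)).
- by rewrite (srepZ piP.1) (rfZl (ipr_form H)).
- have h0 := rnorm_ge0 h; have k0 := rnorm_ge0 k; have x0 := rnorm_ge0 x.
  rewrite (le_trans (ipr_le _ _))// -[leRHS]mulr1 ler_pM ?rnorm_ge0//.
  rewrite (le_trans (srep_contractive piP.1 _ _))// -[leRHS]mulr1.
  by rewrite ler_wpM2l.
- apply: faithful_ipr_le => // h k.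
  have [h0|h0] := eqVneq (rnorm h) 0.
    rewrite (rnorm_eq0 h0) (lin0 (srepL piP.1 _)) (rf0l (ipr_form H)).
    by rewrite rnorm0 mulr0 mul0r.
  have [k0|k0] := eqVneq (rnorm k) 0.
    by rewrite (rnorm_eq0 k0) (rfC (ipr_form H)) (rf0l (ipr_form H)) rnorm0 mulr0.
  have hp : 0 < rnorm h by rewrite lt_neqAle eq_sym h0 rnorm_ge0.
  have kp : 0 < rnorm k by rewrite lt_neqAle eq_sym k0 rnorm_ge0.
  pose n (z : H) := (rnorm z)^-1%:C *: z.
  have n1 z : rnorm z != 0 -> rnorm (n z) <= 1.
    by move=> z0; rewrite rnormZr ger0_norm ?invr_ge0 ?rnorm_ge0// mulVf.
  have : ipr (pi x (n h)) (n k) <= M.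
    by apply: (xM (fun a => ipr (pi a (n h)) (n k))); exists (n h), (n k); rewrite !n1.
  rewrite (linZ (srepL piP.1 _)) (rfZl (ipr_form H)) (rfZr (ipr_form H)).
  rewrite ler_pdivrMl// ler_pdivrMl// => /le_trans; apply.
  by rewrite le_eqVlt; apply/orP; left; apply/eqP; ring.
Qed.

Variables (G : topologicalGroupType) (mu : {measure set (borel G) -> \bar R}).
Hypothesis muP : left_haar_measure mu.
Hypothesis hausG : hausdorff_space G.

Lemma faithful_bochner (F : G -> A) : Cc F ->
  exists a, forall h k, ipr (pi a h) k = haarI mu (fun t => ipr (pi (F t) h) k).
Proof.
move=> cF; have [a aP] := bochner_integral muP hausG faithful_norming cF.
exists a => h k.
have pos (z : H) : 0 < 1 + rnorm z by rewrite ltr_wpDr ?rnorm_ge0.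
pose n (z : H) := (1 + rnorm z)^-1%:C *: z.
have n1 z : rnorm (n z) <= 1.
  rewrite rnormZr ger0_norm ?invr_ge0 ?(ltW (pos z))// ler_pdivrMl// mulr1.
  by rewrite lerDr.
have nE z : z = (1 + rnorm z)%:C *: n z.
  by rewrite scalerA -rmorphM mulfV ?scale1r// gt_eqF.
have e : ipr (pi a (n h)) (n k) = haarI mu (fun t => ipr (pi (F t) (n h)) (n k)).
  by apply: (aP (fun a => ipr (pi a (n h)) (n k))); exists (n h), (n k).
have cl : CcR (fun t => ipr (pi (F t) (n h)) (n k)).
  apply: (@norming_CcR _ _ _ _ faithful_norming F (fun a => ipr (pi a (n h)) (n k)) cF).
  by exists (n h), (n k).
have sc a0 : ipr (pi a0 h) k =
    (1 + rnorm h) * (1 + rnorm k) * ipr (pi a0 (n h)) (n k).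
  rewrite {1}(nE h) {1}(nE k) (linZ (srepL piP.1 _)) (rfZl (ipr_form H)).
  by rewrite (rfZr (ipr_form H)) mulrA.
by rewrite sc e -(haarIZ muP hausG)//; congr haarI; apply/funext => t; rewrite sc.
Qed.

End FaithfulNorming.

Section Slice.
Variables (R : realType) (A : cstarAlgebra R) (G : topologicalGroupType).
Variables (alpha : G -> A -> A) (mu : {measure set (borel G) -> \bar R}).
Variables (H : hilbertSpace R) (pi : A -> H -> H) (L2 : L2space mu H).
Hypothesis hausG : hausdorff_space G.
Hypothesis dynP : dynamical_system alpha.
Hypothesis muP : left_haar_measure mu.
Hypothesis piP : faithful_rep pi.
Local Notation cl := (L2_class L2).
Local Notation I := (haarI mu).
Local Notation tpi := (@tilde_pi R A G alpha mu H pi L2).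
Local Notation trans := (@translation R G mu H L2).
Local Notation intop := (@integrated_op R A G alpha mu H pi L2).

Definition embed (z : G -> R) (h : H) : L2 := cl (fun t => (z t)%:C *: h).

Lemma embed_linear z : CcR z -> linear (embed z).
Proof.
move=> cz k h h'; rewrite /embed -cl_lin; try exact: CcRZv.
congr (cl _); apply/funext => t.
rewrite scalerDr scalerA mulrC -scalerA; by [].
Qed.

Lemma ipr_embed z h k : CcR z -> ipr (embed z h) (embed z k) = I (fun t => z t ^+ 2) * ipr h k.
Proof.
move=> cz; rewrite ipr_cl; try exact: CcRZv.
rewrite mulrC -(haarIZ muP hausG); last by rewrite /CcR; apply: CcRM => //; exact: cz.1.
congr haarI; apply/funext => t.
by rewrite (rfZl (ipr_form H)) (rfZr (ipr_form H)); ring.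
Qed.

Lemma trans_embed s z h : CcR z -> trans s (embed z h) = embed (fun t => z (s^-1 * t)%g) h.
Proof.
by move=> cz; have [_ e _] := translationP L2 hausG muP s; rewrite e//; exact: CcRZv.
Qed.

Lemma CcR_shift s (z : G -> R) : CcR z -> CcR (fun t => z (s^-1 * t)%g).
Proof.
move=> [cz [C cC Cz]]; split.
  move=> t; apply: (@continuous_comp _ _ _ (fun t : G => (s^-1 * t)%g) z);
     [exact: continuous_mulgl|exact: cz].
exists [set (s * t)%g | t in C].
  apply: continuous_compact => //; apply: continuous_subspaceT.
  exact: continuous_mulgl.
move=> t Ct; apply: Cz => Cst; apply: Ct; exists (s^-1 * t)%g => //.
by rewrite mulgA mulgV mul1g.
Qed.

Variable z : G -> R.
Hypothesis cz : CcR z.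
Hypothesis z1 : I (fun t => z t ^+ 2) = 1.
Local Notation J := (embed z).

Lemma rnorm_J h : rnorm (J h) = rnorm h.
Proof.
apply/eqP; rewrite -(eqrXn2 (n := 2))// ?rnorm_ge0// -!ipr_norm ipr_embed//.
by rewrite z1 mul1r.
Qed.

(** Translation is only strongly continuous, but [lambda_s J] is norm continuous:
    [(lambda_s0 - lambda_s) J] multiplies norms by the L^2-distance of the shifts of [z], so a
    single unit vector decides. *)
Lemma trans_J_near s0 (d : R) : 0 < d ->
  \forall s \near s0, forall h, rnorm (trans s0 (J h) - trans s (J h)) <= d * rnorm h.
Proof.
move=> d0; have [[h0 h01]|H0] := unit_vector H; last first.
  have tl s : linear (trans s) by have [[]] := translationP L2 hausG muP s.
  apply: nearW => s h; rewrite (H0 h) (lin0 (embed_linear cz)) (lin0 (tl s)) (lin0 (tl s0)).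
  by rewrite subrr !rnorm0 mulr0.
have := iffLR (continuous_rnormP _) (@translation_continuous _ _ _ _ L2 hausG muP (J h0)) s0 d d0.
apply: filterS => s sd h.
have E h' : rnorm (trans s0 (J h') - trans s (J h')) ^+ 2 =
    I (fun t => (z (s0^-1 * t)%g - z (s^-1 * t)%g) ^+ 2) * rnorm h' ^+ 2.
  have cB : CcR (fun t => z (s0^-1 * t)%g - z (s^-1 * t)%g).
    by apply: CcRB; exact: CcR_shift.
  rewrite !trans_embed// -clB; try exact/CcRZv/CcR_shift.
  rewrite -(ipr_norm h') -ipr_embed// ipr_norm; congr (rnorm (cl _) ^+ 2).
  by apply/funext => t; rewrite rmorphB scalerBl.
have h0' := E h0; rewrite h01 expr1n mulr1 in h0'.
rewrite -(ler_pXn2r (n := 2))// ?nnegrE ?mulr_ge0 ?rnorm_ge0 ?(ltW d0)//.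
rewrite E -h0' exprMn ler_wpM2r ?sqr_ge0//.
by rewrite ler_pXn2r ?nnegrE ?rnorm_ge0 ?(ltW d0)// ltW.
Qed.

(* [pi a = J^* X J], with [J h] the class of [t |-> z t h]. *)
Definition slice_rel (X : L2 -> L2) (a : A) : Prop :=
  forall h k, ipr (X (J h)) (J k) = ipr (pi a h) k.

Lemma slice_uniq X a b : slice_rel X a -> slice_rel X b -> a = b.
Proof. by move=> Xa Xb; apply: (faithful_ipr_inj piP) => h k; rewrite -Xa Xb. Qed.

Lemma slice_lin (k : R[i]) X Y a b : slice_rel X a -> slice_rel Y b ->
  slice_rel (k *: X + Y) (k *: a + b).
Proof.
move=> Xa Yb h l; rewrite (_ : (k *: X + Y) (J h) = k *: X (J h) + Y (J h))//.
rewrite (srepD piP.1) (srepZ piP.1) !(rfDl (ipr_form _)) !iprZ -(linZ (embed_linear cz)).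
by rewrite !Xa Yb.
Qed.

Lemma slice0 : slice_rel 0 0.
Proof. by move=> h k; rewrite (srep0 piP.1) !(rf0l (ipr_form _)). Qed.

Lemma slice_sum n (X : 'I_n -> L2 -> L2) (c : 'I_n -> R[i]) (a : 'I_n -> A) :
  (forall i, slice_rel (X i) (a i)) ->
  slice_rel (\sum_(i < n) c i *: X i) (\sum_(i < n) c i *: a i).
Proof.
move=> Xa; elim/big_rec2: _ => [|i x y _ xy]; first exact: slice0.
exact: slice_lin.
Qed.

Lemma slice_le X a (M : R) : 0 <= M -> slice_rel X a ->
  (forall x, rnorm (X x) <= M * rnorm x) -> rnorm a <= M.
Proof.
move=> M0 Xa XM; apply: (faithful_ipr_le piP M0) => h k.
rewrite -Xa (le_trans (ipr_le _ _))// rnorm_J ler_wpM2r ?rnorm_ge0//.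
by rewrite (le_trans (XM _))// rnorm_J.
Qed.

Lemma slice_mx n (X : 'M[L2 -> L2]_n) (a : 'M[A]_n) (M : R) : 0 <= M ->
  (forall i j, slice_rel (X i j) (a i j)) ->
  (forall v, vnorm (mxact X v) <= M * vnorm v) ->
  forall v, vnorm (ract pi a v) <= M * vnorm v.
Proof.
move=> M0 Xa XM v.
have vJ (u : 'I_n -> H) : vnorm (J \o u) = vnorm u.
  by rewrite !vnormE; congr Num.sqrt; apply: eq_bigr => i _; rewrite rnorm_J.
apply: (form_norm_le (vform H n)); first by rewrite mulr_ge0 ?vnorm_ge0.
move=> u; rewrite -/(vnorm u) -(vJ u) -(vJ v).
apply: le_trans (_ : _ <= vnorm (mxact X (J \o v)) * vnorm (J \o u)) _; last first.
  by rewrite ler_wpM2r ?vnorm_ge0.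
apply: le_trans (rf_cauchy_schwarz (vform L2 n) _ _).
rewrite /sum_form le_eqVlt; apply/orP; left; apply/eqP.
apply: eq_bigr => i _; rewrite ractE /mxact !(rf_suml (ipr_form _)).
by apply: eq_bigr => j _; rewrite /= Xa.
Qed.

Lemma slice_tilde_pi a s : exists b, slice_rel (fun x => tpi a (trans s x)) b.
Proof.
have ca : continuous (fun t => alpha t^-1%g a).
  move=> u; apply: (@continuous_comp _ _ _ (fun t : G => t^-1%g) (fun t => alpha t a)).
    exact: invg_continuous.
  exact: dyn_continuous dynP _ _.
have czz : CcR (fun t => z (s^-1 * t)%g * z t).
  by apply: CcRM => //; have := CcR_shift s cz; case.
(* The inner integral [b(s) = \int z(s^-1 t) z(t) alpha_{t^-1}(a) dt]. *)
have [b bP] := faithful_bochner piP muP hausG (CcZ (CcR_Cc czz) ca).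
exists b => h k; rewrite bP.
have cm : Cc (fun t => (z (s^-1 * t)%g)%:C *: h) by exact/CcRZv/CcR_shift.
have [_ te _] := tilde_piP L2 hausG dynP muP piP a.
rewrite trans_embed// te// ipr_cl; [|exact: Cc_multiplier|exact: CcRZv].
congr haarI; apply/funext => t; rewrite /multiplier.
rewrite (linZ (srepL piP.1 _)) (srepZ piP.1) !(rfZl (ipr_form H)) (rfZr (ipr_form H)).
by rewrite mulrA.
Qed.

Lemma slice_integrated (f : G -> R[i]) a : Cc (f : G -> R[i]^o) ->
  exists b, slice_rel (intop f a) b.
Proof.
move=> cf; have [b bP] := choice (slice_tilde_pi a).
have [[tl _] _ tn] := tilde_piP L2 hausG dynP muP piP a.
(* Norm continuity is required to integrate [f b] in [A]. It comes from [trans_J_near], whose bound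
   is uniform in [h]. *)
have cb : continuous b.
  apply/continuous_rnormP => s e e0.
  have d0 : 0 < e / (1 + rnorm a) / 2 by rewrite !divr_gt0// ltr_wpDr ?rnorm_ge0.
  apply: filterS (trans_J_near s d0) => u su.
  apply: (@le_lt_trans _ _ (e / 2)); last by lra.
  apply: (faithful_ipr_le piP); first by lra.
  move=> h k; rewrite (srepB piP.1) iprBl -!bP -iprBl -linB//.
  rewrite (le_trans (ipr_le _ _))// rnorm_J ler_wpM2r ?rnorm_ge0//.
  rewrite (le_trans (tn _))//.
  have a0 := rnorm_ge0 a; have := su h; have := rnorm_ge0 h.
  set X := rnorm (_ - _); set y := rnorm h => y0 Xy.
  have : rnorm a * X <= rnorm a * (e / (1 + rnorm a) / 2 * y) by rewrite ler_wpM2l.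
  move=> /le_trans; apply.
  have -> : rnorm a * (e / (1 + rnorm a) / 2 * y) = (rnorm a / (1 + rnorm a)) * (e / 2 * y).
    by field; rewrite gt_eqF// ltr_wpDr.
  rewrite ler_piMl ?mulr_ge0// ?(ltW e0)// ler_pdivrMr ?ltr_wpDr// mul1r.
  by rewrite lerDr.
have [c cP] := faithful_bochner piP muP hausG (CcZ cf cb).
exists c => h k; have [_ ->] := integrated_opP L2 hausG dynP muP piP a cf.
rewrite cP; congr haarI; apply/funext => s.
rewrite /integrand (srepZ piP.1) !iprZ -(linZ (embed_linear cz)) -!bP.
by [].
Qed.

(** Slices of approximants from the span form a Cauchy sequence, as slicing is contractive into [A];
    completeness of [A] replaces closedness of pi(A). *)
Lemma slice_exists X : reduced_crossed_product alpha pi L2 X ->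
  exists a, slice_rel X a.
Proof.
move=> [[Xl _] Xapp].
have spanP Y : integrated_span alpha pi Y -> linear Y /\ exists a, slice_rel Y a.
  move=> [n [c [f [a [cf ->]]]]]; split.
    move=> k x y; rewrite !fct_sumE /= scaler_sumr -big_split/=; apply: eq_bigr => i _.
    have [[l _] _] := integrated_opP L2 hausG dynP muP piP (a i) (cf i).
    by rewrite [LHS]/GRing.scale/= l scalerDr !scalerA mulrC.
  have [b bP] := choice (fun i => slice_integrated (a i) (cf i)).
  by exists (\sum_(i < n) c i *: b i); exact: slice_sum.
have ex n : exists Ya : (L2 -> L2) * A,
    (forall x, rnorm (X x - Ya.1 x) <= rate R n * rnorm x) /\ slice_rel Ya.1 Ya.2.
  have [Y Ysp XY] := Xapp _ (rate_gt0 R n).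
  have [Yl [a aP]] := spanP Y Ysp; exists (Y, a); split=> //= x.
  have XYl : linear (X - Y).
    move=> k u v; rewrite (_ : (X - Y) _ = X (k *: u + v) - Y (k *: u + v))//.
    by rewrite Xl Yl opprD addrACA -scalerBr.
  exact: (opnorm_le XYl (ltW XY)).
have [Ya YaP] := choice ex.
have r0 := rate_gt0 R.
have diff n m : rnorm ((Ya m).2 - (Ya n).2) <= rate R m + rate R n.
  have [nX nS] := YaP n; have [mX mS] := YaP m.
  have dS : slice_rel (-1 *: (Ya n).1 + (Ya m).1) (-1 *: (Ya n).2 + (Ya m).2).
    exact: slice_lin.
  rewrite addrC -scaleN1r; apply: (slice_le _ dS); first by rewrite addr_ge0// ltW.
  move=> x; rewrite (_ : (-1 *: (Ya n).1 + (Ya m).1) x = -1 *: (Ya n).1 x + (Ya m).1 x)//.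
  rewrite scaleN1r addrC (le_trans (rnorm_triangle (X x) _ _))// mulrDl lerD//.
  by rewrite rnormBC.
have [||a aP] := @rnorm_complete R A (fun n => (Ya n).2) (fun n => 2 * rate R n).
- move=> n m nm; rewrite (le_trans (diff n m))//.
  have : rate R m <= rate R n.
    by rewrite ler_wpM2l// lef_pV2 ?posrE ?ltr0n// ler_nat; lia.
  lra.
- by rewrite -(mulr0 2); apply: cvgM; [exact: cvg_cst|exact: rate_cvg0].
exists a => h k; apply/eqP; rewrite -subr_eq0 -normr_le0.
apply: (@le_rate0 R _ (3 * rnorm h * rnorm k)) => n; have [nX nS] := YaP n.
have h1 u v : ipr (X (J u)) (J v) - ipr ((Ya n).1 (J u)) (J v) <= rate R n * rnorm u * rnorm v.
  rewrite -iprBl (le_trans (ipr_le _ _))// rnorm_J ler_wpM2r ?rnorm_ge0//.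
  by rewrite (le_trans (nX _))// rnorm_J.
have h2 u v : ipr (pi (Ya n).2 u) v - ipr (pi a u) v <= 2 * rate R n * rnorm u * rnorm v.
  rewrite -iprBl -(srepB piP.1) (le_trans (ipr_le _ _))// ler_wpM2r ?rnorm_ge0//.
  by rewrite (le_trans (srep_contractive piP.1 _ _))// ler_wpM2r ?rnorm_ge0.
(* The inequalities at [- h] supply the lower half of the absolute value. *)
have := h1 h k; have := h2 h k; have := h1 (- h) k; have := h2 (- h) k.
have N (u : H) : J (- u) = - J u by rewrite -scaleN1r (linZ (embed_linear cz)) scaleN1r.
have NX (Y : L2 -> L2) u : linear Y -> Y (- u) = - Y u.
  by move=> Yl; rewrite -scaleN1r (linZ Yl) scaleN1r.
have NP b u : pi b (- u) = - pi b u.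
  by rewrite -scaleN1r (linZ (srepL piP.1 _)) scaleN1r.
rewrite !nS !rnormN !NP N NX// !(rfNl (ipr_form _)).
rewrite ler_norml => e1 e2 e3 e4; apply/andP; split; lra.
Qed.

End Slice.

(** * The smearing map *)

Section MatrixNorm.
Variables (R : realType) (A : cstarAlgebra R) (n : nat).
Implicit Types x : 'M[A]_n.

Lemma srep_mx_linear (H : hilbertSpace R) (sigma : A -> H -> H) x :
  star_representation sigma -> forall i j, linear (map_mx sigma x i j).
Proof. by move=> sP i j; rewrite mxE; exact: srepL. Qed.

Lemma mxnorm_le (H : hilbertSpace R) (pi : A -> H -> H) x (M : R) :
  faithful_rep pi -> 0 <= M ->
  (forall v, vnorm (ract pi x v) <= M * vnorm v) -> (mxnorm x <= M%:E)%E.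
Proof.
move=> piP M0 xM; apply: ge_ereal_sup => _ [K [sigma [sP ->]]].
apply/(mxopnorm_leP (srep_mx_linear x sP.1) M0).
exact: faithful_mxnorm_le piP sP.1 M0 xM.
Qed.

Lemma le_mxnorm (H : hilbertSpace R) (pi : A -> H -> H) x (M : R) :
  faithful_rep pi -> 0 <= M -> (mxnorm x <= M%:E)%E ->
  forall v, vnorm (ract pi x v) <= M * vnorm v.
Proof.
move=> piP M0 xM; apply/(mxopnorm_leP (srep_mx_linear x piP.1) M0).
by apply: le_trans xM; apply: ereal_sup_ubound; exists H, pi.
Qed.

End MatrixNorm.

Section Amplification.
Variables (R : realType) (A : cstarAlgebra R) (G : topologicalGroupType).
Variables (alpha : G -> A -> A) (mu : {measure set (borel G) -> \bar R}).
Variables (H : hilbertSpace R) (pi : A -> H -> H) (L2 : L2space mu H).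
Hypothesis hausG : hausdorff_space G.
Hypothesis dynP : dynamical_system alpha.
Hypothesis muP : left_haar_measure mu.
Hypothesis piP : faithful_rep pi.
Local Notation cl := (L2_class L2).
Local Notation I := (haarI mu).
Local Notation tpi := (@tilde_pi R A G alpha mu H pi L2).
Local Notation trans := (@translation R G mu H L2).
Local Notation intop := (@integrated_op R A G alpha mu H pi L2).

Let tpiL a : linear (tpi a).
Proof. by have [[]] := tilde_piP L2 hausG dynP muP piP a. Qed.
Let tpi_le a x : rnorm (tpi a x) <= rnorm a * rnorm x.
Proof. by have [_ _] := tilde_piP L2 hausG dynP muP piP a; apply. Qed.
Let tpiE a xi : Cc xi -> tpi a (cl xi) = cl (multiplier alpha pi a xi).
Proof. by have [_ + _] := tilde_piP L2 hausG dynP muP piP a; apply. Qed.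

(** On classes of C_c functions the identity is pointwise; the defect is an operator bounded by [C]
    that vanishes on this dense subspace. *)
Lemma tilde_pi_linear (k : R[i]) a b x : tpi (k *: a + b) x = k *: tpi a x + tpi b x.
Proof.
apply/eqP; rewrite -subr_eq0; apply/eqP.
pose C := rnorm (k *: a + b) + complex.Re `|k| * rnorm a + rnorm b.
apply: (@rnorm_le_rate0 _ _ _ C) => n.
have [xs /(_ n)[cn dn]] := cl_approx x.
pose y := x - cl (xs n).
have -> : tpi (k *: a + b) x - (k *: tpi a x + tpi b x) =
    tpi (k *: a + b) y - (k *: tpi a y + tpi b y).
  have e : tpi (k *: a + b) (cl (xs n)) = k *: tpi a (cl (xs n)) + tpi b (cl (xs n)).
    rewrite !tpiE// -cl_lin; try exact: Cc_multiplier.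
    congr (cl _); apply/funext => t; rewrite /multiplier (dyn_linear dynP) (srepD piP.1).
    by rewrite (srepZ piP.1).
  have -> : x = y + cl (xs n) by rewrite subrK.
  by rewrite !(linD (tpiL _)) e scalerDr [X in _ - X]addrACA opprD addrACA subrr addr0.
have h0 := tpi_le (k *: a + b) y; have h1 := tpi_le a y; have h2 := tpi_le b y.
have K0 : 0 <= complex.Re `|k| by rewrite normc_def/= sqrtr_ge0.
have := rnormD (tpi (k *: a + b) y) (- (k *: tpi a y + tpi b y)).
have := rnormD (k *: tpi a y) (tpi b y); rewrite rnormN rnormZ.
have : C * rnorm y <= C * rate R n.
  by rewrite ler_wpM2l// !addr_ge0// ?mulr_ge0// ?rnorm_ge0.
have : complex.Re `|k| * rnorm (tpi a y) <= complex.Re `|k| * (rnorm a * rnorm y).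
  by rewrite ler_wpM2l.
rewrite /C; nra.
Qed.

(** On C_c functions the matrix acts fibrewise through [twisted_rep], a contraction at every t, and
    the squared norms are integrated. The bound [crude] then gives the continuity needed for
    density. *)
Lemma tilde_pi_mx n (x : 'M[A]_n) : (mxnorm x <= 1%:E)%E ->
  forall v, vnorm (mxact (map_mx tpi x) v) <= vnorm v.
Proof.
move=> x1.
have main (xi : 'I_n -> G -> H) : (forall i, Cc (xi i)) ->
    vnorm (mxact (map_mx tpi x) (fun j => cl (xi j))) <= vnorm (fun j => cl (xi j)).
  move=> cx; rewrite -(ler_pXn2r (n := 2))// ?nnegrE ?vnorm_ge0// !sqr_vnorm.
  pose w i t := \sum_(j < n) multiplier alpha pi (x i j) (xi j) t.
  have cw i : Cc (w i) /\ mxact (map_mx tpi x) (fun j => cl (xi j)) i = cl (w i).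
    rewrite /mxact; under eq_bigr do rewrite mxE tpiE//.
    rewrite /w -fct_sumE.
    have cl0 : cl (0 : G -> H) = 0.
      apply/rnorm_eq0/eqP; rewrite -sqrf_eq0 rnorm_cl.
        under eq_fun do rewrite rnorm0 expr0n.
        by rewrite haarI0.
      split; first by move=> t; exact: cvg_cst.
      by exists set0 => //; exact: compact0.
    elim/big_rec2: _ => [|j y1 y2 _ [c ->]].
      by split=> //; split; [move=> t; exact: cvg_cst|exists set0 => //; exact: compact0].
    have cm := Cc_multiplier dynP piP (x i j) (cx j).
    split; first exact: CcD.
    by have := cl_lin L2 1 cm c; rewrite !scale1r => ->.
  under eq_bigr => i _ do rewrite (cw i).2 (rnorm_cl L2 (cw i).1).
  under [leRHS]eq_bigr => i _ do rewrite (rnorm_cl L2 (cx i)).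
  have [c1 <-] := haarI_sum muP hausG (index_enum 'I_n) (fun i => Cc_sqr_rnorm (cw i).1).
  have [c2 <-] := haarI_sum muP hausG (index_enum 'I_n) (fun i => Cc_sqr_rnorm (cx i)).
  apply: (haarI_le muP hausG) => // t.
  rewrite -(sqr_vnorm (fun i => w i t)) -(sqr_vnorm (fun i => xi i t)).
  rewrite ler_pXn2r ?nnegrE ?vnorm_ge0//.
  have := le_mxnorm (twisted_rep dynP piP t^-1%g) ler01 x1 (fun i => xi i t).
  rewrite mul1r; congr (vnorm _ <= _); apply/funext => i.
  by rewrite ractE.
move=> v; pose K := \sum_(i < n) \sum_(j < n) rnorm (x i j).
have mxactB u w : mxact (map_mx tpi x) (u - w) =
    mxact (map_mx tpi x) u - mxact (map_mx tpi x) w.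
  apply/funext => i.
  transitivity (mxact (map_mx tpi x) u i - mxact (map_mx tpi x) w i) => //.
  rewrite /mxact -sumrB; apply: eq_bigr => j _; rewrite mxE.
  by rewrite -(linB (tpiL _)).
have crude u : vnorm (mxact (map_mx tpi x) u) <= K * vnorm u.
  rewrite (le_trans (vnorm_le_sum _))// mulr_suml; apply: ler_sum => i _.
  rewrite (le_trans (rnorm_sum _ _ _))// mulr_suml; apply: ler_sum => j _.
  rewrite mxE (le_trans (tpi_le _ _))// ler_wpM2l ?rnorm_ge0//.
  exact: rnorm_le_vnorm.
have K0 : 0 <= K by do 2 (apply: sumr_ge0 => ? _); exact: rnorm_ge0.
rewrite -subr_le0; apply: (@le_rate0 R _ ((K + 1) * n%:R)) => k.
have ex j : exists xi, Cc xi /\ rnorm (v j - cl xi) <= rate R k.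
  by have [xs /(_ k)] := cl_approx (v j); exists (xs k).
have [xi xiP] := choice ex.
pose u j := cl (xi j).
have vu : vnorm (v - u) <= n%:R * rate R k.
  rewrite (le_trans (vnorm_le_sum _))//.
  apply: (@le_trans _ _ (\sum_(i < n) rate R k)).
    by apply: ler_sum => i _; exact: (xiP i).2.
  by rewrite sumr_const card_ord mulr_natl.
have h1 := main xi (fun i => (xiP i).1); rewrite -/u in h1.
have h2 := crude (v - u); rewrite mxactB in h2.
have h3 := form_normD (vform L2 n) (mxact (map_mx tpi x) v - mxact (map_mx tpi x) u)
  (mxact (map_mx tpi x) u).
rewrite subrK -!/(vnorm _) in h3.
have h4 := form_normD (vform L2 n) (u - v) v; rewrite subrK -!/(vnorm _) in h4.
have h5 : vnorm (u - v) = vnorm (v - u) by rewrite -opprB /vnorm (form_normN (vform L2 n)).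
have h6 : (K + 1) * vnorm (v - u) <= (K + 1) * (n%:R * rate R k).
  by rewrite ler_wpM2l// addr_ge0.
rewrite -mulrA; lra.
Qed.

Variable phi : G -> R.
Hypothesis cphi : CcR phi.
Hypothesis phi0 : forall s, 0 <= phi s.
Hypothesis phi1 : I phi = 1.

(* [smear a] is [tilde_pi a] times the contraction [\int phi(s) lambda_s ds]. *)
Definition smear (a : A) : L2 -> L2 := intop (fun s => (phi s)%:C) a.

Let smearP a := integrated_opP L2 hausG dynP muP piP a (CcR_Cc cphi).

Lemma ipr_smear a x y :
  ipr (smear a x) y = I (fun s => phi s * ipr (tpi a (trans s x)) y).
Proof.
rewrite (smearP a).2; congr haarI; apply/funext => s.
by rewrite /integrand (rfZl (ipr_form _)).
Qed.

Lemma CcR_smear a x y : CcR (fun s => phi s * ipr (tpi a (trans s x)) y).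
Proof.
have := Cc_iprl y (Cc_integrand hausG dynP muP piP a x (CcR_Cc cphi)).
congr CcR; apply/funext => s; by rewrite /integrand (rfZl (ipr_form _)).
Qed.

Lemma smear_linear : linear smear.
Proof.
move=> k a b; apply/funext => x; apply: ipr_inj => y.
rewrite (_ : (k *: smear a + smear b) x = k *: smear a x + smear b x)//.
rewrite (rfDl (ipr_form _)) iprZ !ipr_smear -!(haarIZ muP hausG); try exact: CcR_smear.
rewrite -(haarIB muP hausG); try exact/CcRZ/CcR_smear.
rewrite -(haarID muP hausG); [|by apply: CcRB; exact/CcRZ/CcR_smear|exact: CcR_smear].
congr haarI; apply/funext => s.
by rewrite tilde_pi_linear (rfDl (ipr_form _)) iprZ; ring.
Qed.

Lemma smear_crossed a : reduced_crossed_product alpha pi L2 (smear a).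
Proof.
split; first exact: (smearP a).1.
move=> e e0; exists (smear a).
  exists 1%N, (fun=> 1), (fun _ s => (phi s)%:C), (fun=> a); split.
    by move=> _; exact: CcR_Cc.
  by rewrite big_ord1 scale1r.
apply: (@le_lt_trans _ _ 0%E); last by rewrite lte_fin.
apply: ge_ereal_sup => _ [x _ <-]; rewrite subrr lee_fin.
by rewrite [X in rnorm X](_ : _ = 0)// rnorm0.
Qed.

(** Paired with [u], the smeared matrix is an average, with density [phi], of contractions
    [tilde_pi(x) lambda_s]. *)
Lemma smear_mx n (x : 'M[A]_n) : (mxnorm x <= 1%:E)%E ->
  (mxopnorm (map_mx smear x) <= 1%:E)%E.
Proof.
move=> x1; apply/mxopnorm_leP => //.
  by move=> i j; rewrite mxE; have [[]] := smearP (x i j).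
move=> v; rewrite mul1r.
apply: (form_norm_le (vform L2 n)); first exact: vnorm_ge0.
move=> u; rewrite -/(vnorm u).
have -> : sum_form (@ipr R L2) (mxact (map_mx smear x) v) u =
    I (fun s => phi s * sum_form (@ipr R L2) (mxact (map_mx tpi x) (trans s \o v)) u).
  have cF i j := CcR_smear (x i j) (v j) (u i).
  have cS i := haarI_sum muP hausG (index_enum 'I_n) (cF i).
  have [_ e] := haarI_sum muP hausG (index_enum 'I_n) (fun i => (cS i).1).
  transitivity (I (fun s => \sum_(i < n) \sum_(j < n)
      phi s * ipr (tpi (x i j) (trans s (v j))) (u i))).
    rewrite e; apply: eq_bigr => i _; rewrite (cS i).2 /mxact (rf_suml (ipr_form _)).
    by apply: eq_bigr => j _; rewrite mxE ipr_smear.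
  congr haarI; apply/funext => s; rewrite mulr_sumr; apply: eq_bigr => i _.
  rewrite /mxact (rf_suml (ipr_form _)) mulr_sumr; apply: eq_bigr => j _.
  by rewrite mxE.
apply: (@le_trans _ _ (I (fun s => vnorm v * vnorm u * phi s))); last first.
  by rewrite (haarIZ muP hausG)// phi1 mulr1.
apply: (haarI_le muP hausG).
- have cF i j := CcR_smear (x i j) (v j) (u i).
  have cS i := haarI_sum muP hausG (index_enum 'I_n) (cF i).
  have [c _] := haarI_sum muP hausG (index_enum 'I_n) (fun i => (cS i).1).
  move: c; congr CcR; apply/funext => s; rewrite mulr_sumr; apply: eq_bigr => i _.
  rewrite /mxact (rf_suml (ipr_form _)) mulr_sumr; apply: eq_bigr => j _.
  by rewrite mxE.
- exact: CcRZ.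
move=> s; rewrite mulrC ler_wpM2r//.
rewrite (le_trans (rf_cauchy_schwarz (vform L2 n) _ _))// ler_wpM2r ?vnorm_ge0//.
rewrite (le_trans (tilde_pi_mx x1 _))// !vnormE ler_wsqrtr// ler_sum// => i _.
rewrite ler_pXn2r ?nnegrE ?rnorm_ge0//.
by have [_ _] := translationP L2 hausG muP s; apply.
Qed.

End Amplification.

(** * The approximating maps *)

Section FiniteRank.
Variables (K : fieldType) (U V : lmodType K) (f : U -> V).
Hypothesis flin : linear f.

Let fZD k x y : f (x + k *: y) = f x + k *: f y.
Proof. by rewrite addrC flin addrC. Qed.

(** The vectors [e] witnessing the rank of T_gamma may lie outside the crossed product and then have
    no slice; values of [f] do. Gaussian elimination: an [x0] with nonzero coefficient at [e ord0]
    serves as pivot, and [B] shrinks to the inputs without that coefficient. *)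
Lemma finite_rank_lift (m : nat) (e : 'I_m -> V) (B : set U) :
  (forall k x y, B x -> B y -> B (x + k *: y)) ->
  (forall x, B x -> exists c : 'I_m -> K, f x = \sum_(i < m) c i *: e i) ->
  exists n (u : 'I_n -> U), forall x, B x ->
    exists c : 'I_n -> K, f x = \sum_(i < n) c i *: f (u i).
Proof.
elim: m e B => [|m IH] e B BD Be.
  exists 0%N, (fun=> 0) => x /Be[c ->]; exists (fun=> 0).
  by rewrite !big_ord0.
pose e' i := e (lift ord0 i).
pose B' := [set x | B x /\ exists c : 'I_m -> K, f x = \sum_(i < m) c i *: e' i].
have [n [u uP]] : exists n (u : 'I_n -> U), forall x, B' x ->
    exists c : 'I_n -> K, f x = \sum_(i < n) c i *: f (u i).
  apply: (IH e') => [k x y [Bx [c xc]] [By [d yd]]|x []//].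
  split; first exact: BD.
  exists (fun i => c i + k * d i); rewrite fZD xc yd scaler_sumr -big_split/=.
  by apply: eq_bigr => i _; rewrite scalerDl scalerA.
have [[x0 [Bx0 [c0 [x0e c00]]]]|none] := pselect (exists x0, B x0 /\
    exists c : 'I_m.+1 -> K, f x0 = \sum_(i < m.+1) c i *: e i /\ c ord0 != 0).
  exists n.+1, (fun i => oapp u x0 (unlift ord0 i)) => x Bx.
  have [c xe] := Be _ Bx.
  pose k := c ord0 / c0 ord0.
  have [|d dP] := uP (x + - k *: x0).
    split; first exact: BD.
    exists (fun i => c (lift ord0 i) - k * c0 (lift ord0 i)).
    rewrite fZD xe x0e !big_ord_recl /= scalerDr scalerA mulNr /k divfK//.
    rewrite addrACA -scalerDl subrr scale0r add0r scaler_sumr -big_split/=.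
    by apply: eq_bigr => i _; rewrite scalerDl scalerA mulNr.
  exists (fun i => oapp d k (unlift ord0 i)).
  rewrite big_ord_recl /= unlift_none /=.
  under eq_bigr do rewrite liftK /=.
  by rewrite -dP fZD scaleNr addrC subrK.
exists n, u => x Bx; apply: uP; split=> //.
have [c xe] := Be _ Bx; exists (fun i => c (lift ord0 i)).
rewrite xe big_ord_recl; have [->|c0] := eqVneq (c ord0) 0.
  by rewrite scale0r add0r.
by case: none; exists x; split=> //; exists c.
Qed.

End FiniteRank.

Section Approximation.
Variables (R : realType) (A : cstarAlgebra R) (G : topologicalGroupType).
Variables (alpha : G -> A -> A) (mu : {measure set (borel G) -> \bar R}).
Variables (H : hilbertSpace R) (pi : A -> H -> H) (L2 : L2space mu H).
Hypothesis hausG : hausdorff_space G.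
Hypothesis lcG : locally_compact [set: G].
Hypothesis dynP : dynamical_system alpha.
Hypothesis muP : left_haar_measure mu.
Hypothesis piP : faithful_rep pi.
Local Notation cl := (L2_class L2).
Local Notation I := (haarI mu).
Local Notation tpi := (@tilde_pi R A G alpha mu H pi L2).
Local Notation trans := (@translation R G mu H L2).
Local Notation smear := (@smear R A G alpha mu H pi L2).

Lemma action_near1 (F : seq A) (e : R) : 0 < e ->
  \forall t \near (1%g : G), forall a, a \in F -> rnorm (alpha t^-1%g a - a) < e.
Proof.
move=> e0; elim: F => [|a F IH]; first exact: nearW.
have ca : continuous (fun t => alpha t^-1%g a).
  move=> u; apply: (@continuous_comp _ _ _ (fun t : G => t^-1%g) (fun t => alpha t a)).
    exact: invg_continuous.
  exact: dyn_continuous dynP _ _.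
(* [alpha 1] is idempotent and injective, hence the identity. *)
have a1 : alpha 1%g a = a.
  apply: (bij_inj (dyn_bijective dynP 1%g)).
  by rewrite -(dyn_morphism dynP) mul1g.
have := iffLR (continuous_rnormP _) ca 1%g e e0; rewrite invg1 a1 => na.
apply: filterS2 na IH => t na tF b; rewrite inE => /orP[/eqP ->|/tF//].
by rewrite rnormBC.
Qed.

Lemma translation1 x : trans 1%g x = x.
Proof.
have [[tl _] tE tn] := translationP L2 hausG muP 1%g.
apply/eqP; rewrite -subr_eq0; apply/eqP; apply: (@rnorm_le_rate0 _ _ _ 2) => n.
have [xs /(_ n)[cn dn]] := cl_approx x.
have e : trans 1%g (cl (xs n)) = cl (xs n).
  by rewrite tE//; congr (cl _); apply/funext => t; rewrite /translate invg1 mul1g.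
have := rnorm_triangle (trans 1%g (cl (xs n))) (trans 1%g x) x.
rewrite -(linB tl) e (rnormBC (cl _)).
by have := tn (x - cl (xs n)); lra.
Qed.

(** Replacing [lambda_s] by 1 ([step1]) and [alpha_{t^-1}(a)] by [a] ([step2]) each costs [e / 2].
    The choice of [phi] comes after that of [z], since the neighbourhood where [lambda_s J] is near
    [J] depends on [z]. *)
Lemma smear_slice_approx (F : seq A) (e : R) : 0 < e ->
  exists z phi : G -> R,
    [/\ CcR z, I (fun t => z t ^+ 2) = 1, CcR phi, forall s, 0 <= phi s & I phi = 1] /\
    forall a b, a \in F -> slice_rel pi z (smear phi a) b -> rnorm (b - a) <= e.
Proof.
move=> e0; have e2 : 0 < e / 2 by rewrite divr_gt0.
have [f [cf f0 f1 fO]] := bump_function R hausG lcG (action_near1 F e2).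
have cff : CcR (fun t => f t ^+ 2) by apply: CcRM => //; case: cf.
have If : 0 < I (fun t => f t ^+ 2).
  apply: (haarI_gt0 hausG muP cff); last exact: exprn_gt0.
  by move=> t; exact: sqr_ge0.
pose q := Num.sqrt (I (fun t => f t ^+ 2)).
have q0 : 0 < q by rewrite sqrtr_gt0.
pose z t := q^-1 * f t.
have cz : CcR z by exact: CcRZ.
have z1 : I (fun t => z t ^+ 2) = 1.
  have -> : (fun t => z t ^+ 2) = (fun t => (q ^+ 2)^-1 * f t ^+ 2).
    by apply/funext => t; rewrite exprMn exprVn.
  by rewrite (haarIZ muP hausG)// sqr_sqrtr ?(ltW If)// mulVf// gt_eqF.
pose J := @embed R G mu H L2 z.
(* A positive common bound for the norms on [F], so that [d = e / 2 / C] gives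
   [rnorm a * d <= e / 2]. *)
pose C := \sum_(a <- F) rnorm a + 1.
have C1 : 1 <= C by rewrite lerDr sumr_ge0// => a _; exact: rnorm_ge0.
have aC a : a \in F -> rnorm a <= C.
  move=> aF; rewrite /C (big_rem a)//= -addrA lerDl addr_ge0// sumr_ge0// => b _.
  exact: rnorm_ge0.
pose d := e / 2 / C; have d0 : 0 < d by rewrite divr_gt0//; lra.
have [g [cg g0 g1 gO]] := bump_function R hausG lcG
  (trans_J_near L2 hausG muP cz 1%g d0).
have Ig : 0 < I g by exact: (haarI_gt0 hausG muP cg g0 g1).
pose phi s := (I g)^-1 * g s.
have cphi : CcR phi by exact: CcRZ.
have phi0 s : 0 <= phi s by rewrite mulr_ge0// invr_ge0 ltW.
have phi1 : I phi = 1 by rewrite (haarIZ muP hausG)// mulVf// gt_eqF.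
exists z, phi; split=> // a b aF bP.
have [[tl _] tE tn] := tilde_piP L2 hausG dynP muP piP a.
apply: (faithful_ipr_le piP (ltW e0)) => h k.
have rJ := rnorm_J L2 hausG muP cz z1.
rewrite (srepB piP.1) iprBl -bP (ipr_smear hausG dynP muP piP cphi).
have step1 : I (fun s => phi s * ipr (tpi a (trans s (J h))) (J k)) <=
    ipr (tpi a (J h)) (J k) + e / 2 * rnorm h * rnorm k.
  have <- : I (fun s => (ipr (tpi a (J h)) (J k) + e / 2 * rnorm h * rnorm k) * phi s) =
      ipr (tpi a (J h)) (J k) + e / 2 * rnorm h * rnorm k.
    by rewrite (haarIZ muP hausG)// phi1 mulr1.
  apply: (haarI_le muP hausG); [exact: CcR_smear|exact: CcRZ|].
  move=> s; rewrite [leRHS]mulrC.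
  have [->|ps] := eqVneq (phi s) 0; first by rewrite !mul0r.
  have gs : g s != 0 by move: ps; rewrite /phi mulf_eq0 negb_or => /andP[].
  rewrite ler_wpM2l// -lerBlDl -iprBl -(linB tl) (le_trans (ipr_le _ _))//.
  rewrite rJ ler_wpM2r ?rnorm_ge0// (le_trans (tn _))//.
  have := gO s gs h; rewrite translation1 rnormBC -/(J h) => sd.
  have X0 := rnorm_ge0 (trans s (J h) - J h).
  rewrite (le_trans (ler_pM (rnorm_ge0 a) X0 (aC a aF) sd))//.
  by rewrite mulrA /d mulrCA divff ?mulr1//; lra.
have cfa : continuous (fun t => alpha t^-1%g a).
  move=> u; apply: (@continuous_comp _ _ _ (fun t : G => t^-1%g) (fun t => alpha t a)).
    exact: invg_continuous.
  exact: dyn_continuous dynP _ _.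
have step2 : ipr (tpi a (J h)) (J k) <= ipr (pi a h) k + e / 2 * rnorm h * rnorm k.
  rewrite tE; last exact: CcRZv.
  have cm := Cc_multiplier dynP piP a (CcRZv h cz).
  rewrite ipr_cl//; last exact: CcRZv.
  have <- : I (fun t => (ipr (pi a h) k + e / 2 * rnorm h * rnorm k) * z t ^+ 2) =
      ipr (pi a h) k + e / 2 * rnorm h * rnorm k.
    by rewrite (haarIZ muP hausG) ?z1 ?mulr1//; apply: CcRM => //; case: cz.
  apply: (haarI_le muP hausG).
  - exact: (Cc_ipr cm (CcRZv k cz)).
  - by apply: CcRZ; apply: CcRM => //; case: cz.
  move=> t; rewrite /multiplier (linZ (srepL piP.1 _)) (rfZl (ipr_form H)) (rfZr (ipr_form H)).
  rewrite mulrA -expr2 [leRHS]mulrC.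
  have [->|zt] := eqVneq (z t) 0; first by rewrite expr0n !mul0r.
  have ft : f t != 0 by move: zt; rewrite /z mulf_eq0 negb_or => /andP[].
  rewrite ler_wpM2l ?sqr_ge0// -lerBlDl -iprBl -(srepB piP.1) (le_trans (ipr_le _ _))//.
  rewrite ler_wpM2r ?rnorm_ge0// (le_trans (srep_contractive piP.1 _ _))//.
  by rewrite ler_wpM2r ?rnorm_ge0// ltW// (fO t ft).
by rewrite -/J; lra.
Qed.

End Approximation.

(** * The net of finite rank maps on A *)

Theorem corollary3p3 (R : realType) (A : cstarAlgebra R)
    (G : topologicalGroupType) (alpha : G -> A -> A)
    (mu : {measure set (borel G) -> \bar R})
    (H : hilbertSpace R) (pi : A -> H -> H) (L2 : L2space mu H) :
  hausdorff_space G -> locally_compact [set: G] ->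
  dynamical_system alpha ->
  left_haar_measure mu ->
  faithful_rep pi ->
  (Lambda A <= Lambda_op (reduced_crossed_product alpha pi L2))%E.
Proof.
(* Every constant admissible for the crossed product is shown to be admissible for [A]. *)
move=> hausG lcG dynP muP piP; apply: le_ereal_inf => _ [c [I0 [le0 [T [dir frT cbT cvT]]]] <-].
exists c => //.
pose B := reduced_crossed_product alpha pi L2.
have core (F : seq A) (d : R) : 0 < d -> exists Q : A -> A,
    [/\ finite_rank_map [set: A] Q, (cb_norm [set: A] (@mxnorm R A) Q <= c%:E)%E &
        forall a, a \in F -> rnorm (Q a - a) < d].
  (* [d / 2] is spent on [slice (S a)] against [a] and [d / 4] on [T i] against the identity, which
     leaves the total strictly below [d]. *)
  move=> d0; have d2 : 0 < d / 2 by rewrite divr_gt0.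
  have d4 : 0 < d / 4 by rewrite divr_gt0.
  have [z [phi [[cz z1 cphi phi0 phi1] approx]]] :=
    smear_slice_approx L2 hausG lcG dynP muP piP F d2.
  pose S := @smear R A G alpha mu H pi L2 phi.
  have Slin : linear S := smear_linear L2 hausG dynP muP piP cphi.
  have SB a : B (S a) := smear_crossed L2 hausG dynP muP piP cphi a.
  (* Meaningful on [B] only; it is applied to members of [B] alone. *)
  pose slice (X : L2 -> L2) := get [set a | slice_rel pi z X a].
  have sliceP X : B X -> slice_rel pi z X (slice X).
    move=> /(slice_exists hausG dynP muP piP cz z1)[a aP].
    by apply: (getPex (P := [set a | slice_rel pi z X a])); exists a.
  have [i iF] : exists i, forall a, a \in F -> (opnorm (T i (S a) - S a)%R < (d / 4)%:E)%E.
    have [[i0] lerefl letrans ledir] := dir.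
    (* Stated for all later indices, so that directedness can treat the elements of [F] one at a
       time. *)
    have : exists i, forall j, le0 i j -> forall a, a \in F ->
        (opnorm (T j (S a) - S a)%R < (d / 4)%:E)%E.
      elim: F {approx} => [|a F [i iF]]; first by exists i0.
      have [i1 i1P] := cvT _ (SB a) _ d4; have [k [ik i1k]] := ledir i i1.
      exists k => j kj b; rewrite inE => /orP[/eqP ->|bF].
        exact: i1P (letrans _ _ _ i1k kj).
      exact: iF (letrans _ _ _ ik kj) _ bF.
    by move=> [i iF]; exists i; exact: iF.
  pose P a := T i (S a).
  have PB a : B (P a) by exact: frm_stable (frT i) _ (SB a).
  have Plin : linear P.
    by move=> k a b; rewrite /P Slin (frm_linear (frT i) _ (SB a) (SB b)).
  exists (fun a => slice (P a)); split.
  - split=> // [k a b _ _|].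
      apply: (slice_uniq piP (sliceP _ (PB _))).
      by rewrite Plin; apply: (slice_lin piP cz); exact: sliceP.
    have [m [e eP]] := frm_rank (frT i).
    (* The range is now spanned by the values [P (u j)], which lie in [B] and can be sliced. *)
    have [||n [u uP]] := @finite_rank_lift _ _ _ P Plin m e setT => //.
      by move=> a _; exact: (eP _ (SB a)).
    exists n, (fun j => slice (P (u j))) => a _; have [k kP] := uP a Logic.I.
    exists k; apply: (slice_uniq piP (sliceP _ (PB _))); rewrite kP.
    by apply: (slice_sum piP cz) => j; exact: sliceP.
  - apply: ge_ereal_sup => _ [n [x [_ x1 ->]]].
    have Sx1 := smear_mx L2 hausG dynP muP piP cphi phi0 phi1 x1.
    have Px : (mxopnorm (map_mx P x) <= c%:E)%E.
      apply: le_trans (cbT i); apply: ereal_sup_ubound.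
      exists n, (map_mx S x); split=> [j k||]; rewrite ?mxE//; first exact: SB.
      by congr mxopnorm; apply/matrixP => j k; rewrite !mxE.
    have c0 : 0 <= c by rewrite -lee_fin; apply: le_trans Px; exact: mxopnorm_ge0.
    have Pxl j k : linear (map_mx P x j k) by rewrite mxE; case: (PB (x j k)) => -[].
    apply: (mxnorm_le piP c0); apply: (slice_mx hausG muP cz z1 c0 (X := map_mx P x)).
      by move=> j k; rewrite !mxE; exact: sliceP.
    exact/mxopnorm_leP.
  - move=> a aF; have h1 := approx a _ aF (sliceP _ (SB a)).
    have sd : slice_rel pi z (-1 *: S a + P a) (-1 *: slice (S a) + slice (P a)).
      by apply: (slice_lin piP cz); exact: sliceP.
    have PSl : linear (P a - S a).
      have [[Pl _] _] := PB a; have [[Sl _] _] := SB a.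
      move=> k u v; rewrite (_ : (P a - S a) _ = P a (k *: u + v) - S a (k *: u + v))//.
      by rewrite Pl Sl opprD addrACA -scalerBr.
    have h2 : rnorm (-1 *: slice (S a) + slice (P a)) <= d / 4.
      apply: (slice_le hausG muP piP cz z1 (ltW d4) sd) => x.
      have := opnorm_le PSl (ltW (iF a aF)) x.
      rewrite (_ : (P a - S a) x = (-1 *: S a + P a) x)//.
      rewrite (_ : (-1 *: S a + P a) x = -1 *: S a x + P a x)// scaleN1r addrC.
      by [].
    rewrite scaleN1r addrC in h2.
    have := rnorm_triangle (slice (S a)) (slice (P a)) a.
    by lra.
(* The pair [(F, N)] demands error below [rate R N] on [F]; such pairs are directed by inclusion and
   precision. *)
have [Q QP] := choice (fun p : seq A * nat => core p.1 _ (rate_gt0 R p.2)).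
exists (seq A * nat)%type, (fun p q => {subset p.1 <= q.1} /\ (p.2 <= q.2)%N), Q; split.
- split.
  + exact: (inhabits ([::], 0%N)).
  + by move=> p; split.
  + move=> p q r [pq1 pq2] [qr1 qr2]; split; last exact: leq_trans pq2 qr2.
    by move=> x /pq1/qr1.
  + move=> p q; exists (p.1 ++ q.1, maxn p.2 q.2); split; split => /=.
    * by move=> x xp; rewrite mem_cat xp.
    * exact: leq_maxl.
    * by move=> x xp; rewrite mem_cat xp orbT.
    * exact: leq_maxr.
- by move=> p; have [] := QP p.
- by move=> p; have [] := QP p.
- move=> a _ e e0.
  have [N _ Ne] : \forall n \near \oo, rate R n < e.
    have /cvgr0Pnorm_lt/(_ _ e0) := @rate_cvg0 R.
    by apply: filterS => n; apply: le_lt_trans; exact: ler_norm.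
  exists ([:: a], N) => p [ap Np]; have [_ _ /(_ a (ap a (mem_head _ _)))] := QP p.
  by rewrite lte_fin => /lt_trans; apply; exact: Ne.
Qed.
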